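(* Every planar graph with no $4$-cycle (as a subgraph) is $(5,5)$-colorable, i.e., its vertex set can be partitioned into two parts each inducing a subgraph of maximum degree at most $5$.
   Context: All graphs are finite and simple. *)

(* Defs.v *)
From HB Require Import structures.
From mathcomp Require Import all_boot all_order all_algebra.
From mathcomp Require Import all_classical all_reals all_analysis.

Set Implicit Arguments.
Unset Strict Implicit.
Unset Printing Implicit Defensive.

Import Order.TTheory GRing.Theory Num.Theory.
Import numFieldNormedType.Exports.

Local Open Scope classical_set_scope.
Local Open Scope ring_scope.

(* Finite simple graphs are symmetric irreflexive relations on a finType. *)

(* A crossing-free drawing of e in the plane R * R. Each edge xy is drawn as a
   simple arc, parametrized from x to y by [gamma x y] on [0, 1]; only the
   values of gamma on edges and on [0, 1] matter. [gamma x y] and [gamma y x]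
   run through the same arc in opposite directions, hence the disjointness
   clause is about edges with different sets of endpoints. *)
Record plane_drawing (R : realType) (T : finType) (e : rel T)
    (p : T -> R * R) (gamma : T -> T -> R -> R * R) : Prop := PlaneDrawing {
  drawing_inj : injective p ;
  drawing_continuous : forall x y, e x y ->
    {within `[0, 1], continuous (gamma x y)} ;
  drawing_simple : forall x y, e x y ->
    {in `[0, 1] &, injective (gamma x y)} ;
  drawing_start : forall x y, e x y -> gamma x y 0 = p x ;
  drawing_end : forall x y, e x y -> gamma x y 1 = p y ;
  drawing_rev : forall x y, e x y ->
    {in `[0, 1], forall t, gamma y x t = gamma x y (1 - t)} ;
  drawing_vertex : forall x y z, e x y ->
    {in `]0, 1[, forall t, gamma x y t <> p z} ;
  drawing_disjoint : forall x y u v, e x y -> e u v ->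
    [set x; y]%SET <> [set u; v]%SET ->
    {in `]0, 1[ &, forall s t, gamma x y s <> gamma u v t}
}.

Definition planar (R : realType) (T : finType) (e : rel T) : Prop :=
  exists p gamma, @plane_drawing R T e p gamma.

(* [ucycle e c] is the closed walk condition together with [uniq c], so for
   k >= 3 these are the (not necessarily induced) k-cycles of the graph. *)
Definition has_cycle (k : nat) (T : finType) (e : rel T) : Prop :=
  exists c : k.-tuple T, ucycle e c.

Definition induced_max_degree (T : finType) (e : rel T) (A : {set T}) : nat :=
  \max_(x in A) #|[set y in A | e x y]%SET|.

Definition defective_colorable (d1 d2 : nat) (T : finType) (e : rel T) : Prop :=
  exists A B : {set T},
    [/\ (A :|: B = [set: T])%SET, (A :&: B = finset.set0)%SET,
        (induced_max_degree e A <= d1)%N & (induced_max_degree e B <= d2)%N].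

(* Main.v *)
(* The idea is to decompose the graph into a forest and a graph of maximum degree
   at most 5; a proper 2-colouring of the forest is then the required colouring.

   Let X be a set of vertices. Euler's formula, in a planar graph where every edge
   lies in at most one triangle and there is no 4-face, gives the inequality
   sum_(u in X) deg u <= 5 |X| + |N(X)|. By Hall's theorem every vertex y can
   then pick at most one neighbour so that each u is picked at least deg u - 5
   times. The picked edges form a graph with at most one cycle per component,
   and breaking the cycles costs nothing, since a vertex on a cycle of length at
   least 3 is also incident with the edge it has picked itself.

   Euler's inequality is obtained from the arcs of the drawing as follows. On a
   fine square grid, replace each vertex by a block of pixels and each edge by a
   connected set of pixels, which makes the graph a minor of the grid. In the
   grid every even edge set is the boundary of a set of unit squares; modulo 2,
   this passes to minors and gives a family of at least |E| - |V| even edge sets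
   in which each edge occurs at most twice. *)

Require Import Defs.
From mathcomp Require Import all_boot all_order all_algebra.
From mathcomp Require Import zify lra.

Set Implicit Arguments.
Unset Strict Implicit.
Unset Printing Implicit Defensive.

Import Order.TTheory GRing.Theory Num.Theory.

(** * Faces of a minor of the grid *)

Section GridFaces.

Local Open Scope ring_scope.

Lemma addF2 (x : 'F_2) : x + x = 0.
Proof. by apply/val_inj; case: x => [[|[|?]] ?]. Qed.

Lemma addF2_eq (x y : 'F_2) : x + y = 0 -> x = y.
Proof. by move=> xy; rewrite -[x]addr0 -(addF2 y) addrA xy add0r. Qed.

Section MinorFaces.

Variables (P G : finType) (Q : Type) (e1 e2 : G -> P) (s1 s2 : G -> Q).
Variable inner : pred P.

Definition bd (f : G -> 'F_2) (p : P) : 'F_2 :=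
  \sum_g f g * ((e1 g == p)%:R + (e2 g == p)%:R).

(** The host graph on [P] is to be thought of as planar, with faces [Q] and with [s1 g], [s2 g] the
    two sides of [g]: an even edge set without loops bounds a set [w] of faces. *)
Hypothesis even_potential : forall f : G -> 'F_2,
  (forall p, bd f p = 0) -> (forall g, e1 g = e2 g -> f g = 0) ->
  exists w : Q -> 'F_2, forall g, f g = w (s1 g) + w (s2 g).
Hypothesis potential_even : forall (D : Q -> 'F_2) p, inner p ->
  bd (fun g => D (s1 g) + D (s2 g)) p = 0.

Variables (V E : finType) (lab : P -> option V) (lk : E -> G) (a b : E -> V).
Hypothesis lab_inner : forall p, lab p -> inner p.
Hypothesis lk_inj : injective lk.
Hypothesis ab_neq : forall x, a x != b x.
Hypothesis lk_lab : forall x,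
  (lab (e1 (lk x)) = Some (a x) /\ lab (e2 (lk x)) = Some (b x)) \/
  (lab (e1 (lk x)) = Some (b x) /\ lab (e2 (lk x)) = Some (a x)).

(** Connectedness inside the fibre of [v] in homological form: a chain of non-loops within the fibre
    whose boundary is [p + r]. *)
Definition joined v p r := exists2 f : G -> 'F_2,
  forall g, f g != 0 ->
    [/\ lab (e1 g) = Some v, lab (e2 g) = Some v & e1 g != e2 g] &
  forall q, bd f q = (p == q)%:R + (r == q)%:R.

Hypothesis lab_conn : forall v, exists r, forall p, lab p = Some v -> joined v p r.

Definition inc x v : 'F_2 := (a x == v)%:R + (b x == v)%:R.

Lemma lab_inc x v :
  (lab (e1 (lk x)) == Some v)%:R + (lab (e2 (lk x)) == Some v)%:R = inc x v.
Proof.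
by case: (lk_lab x) => -[-> ->]; rewrite /inc !(inj_eq Some_inj) // addrC.
Qed.

Lemma lk_noloop x : e1 (lk x) != e2 (lk x).
Proof.
apply/eqP => E12; have := ab_neq x.
by case: (lk_lab x) => -[]; rewrite E12 => -> [->]; rewrite eqxx.
Qed.

(** Contracting a fibre adds up the boundaries at its points; an edge with both ends in the fibre
    counts twice and so drops out. *)
Lemma bd_sum_lab f v : \sum_(p | lab p == Some v) bd f p =
  \sum_g f g * ((lab (e1 g) == Some v)%:R + (lab (e2 g) == Some v)%:R).
Proof.
rewrite exchange_big /=; apply: eq_bigr => g _; rewrite -mulr_sumr big_split /=.
have H p0 : \sum_(p | lab p == Some v) (p0 == p)%:R = (lab p0 == Some v)%:R :> 'F_2.
  rewrite big_mkcond (bigD1 p0) //= eqxx big1 ?addr0; first by case: ifP.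
  by move=> p; rewrite eq_sym => /negPf ->; case: ifP.
by rewrite !H.
Qed.

(* Push the boundary of the lifted cycle along connecting paths to the root of
   each fibre, where it cancels because c has even degree there. *)
Lemma cycle_lift (c : E -> 'F_2) : (forall v, \sum_x c x * inc x v = 0) ->
  exists2 f : G -> 'F_2,
    (forall p, bd f p = 0) /\ (forall g, e1 g = e2 g -> f g = 0) &
    (forall x, f (lk x) = c x) /\
    (forall g, f g != 0 -> g \in codom lk \/ (lab (e1 g) = lab (e2 g))).
Proof.
move=> cE; have [r rP] := fin_all_exists lab_conn.
pose root p := if lab p is Some v then r v else p.
have Hp p : exists f : G -> 'F_2,
    (forall g, f g != 0 -> [/\ lab (e1 g), lab (e1 g) = lab (e2 g) & e1 g != e2 g]) /\
    (forall q, bd f q = (p == q)%:R + (root p == q)%:R).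
  rewrite /root; case Elab: (lab p) => [v|]; last first.
    exists (fun=> 0); split=> [g|q]; first by rewrite eqxx.
    by rewrite addF2 /bd big1 // => g _; rewrite mul0r.
  have [f f1 f2] := rP v p Elab; exists f; split=> // g /f1 [-> ->].
  by split.
have [pi /all_and2 [pi1 pi2]] := fin_all_exists Hp.
pose l g : 'F_2 := \sum_x c x * (lk x == g)%:R.
have lE x : l (lk x) = c x.
  rewrite /l (bigD1 x) //= eqxx mulr1 big1 ?addr0 // => y yx.
  by rewrite (inj_eq lk_inj) (negPf yx) mulr0.
have l0 g : g \notin codom lk -> l g = 0.
  move=> gN; rewrite /l big1 // => x _; case: eqP => [xg|]; last by rewrite mulr0.
  by rewrite -xg codom_f in gN.
have sumlk (F : G -> 'F_2) : \sum_g l g * F g = \sum_x c x * F (lk x).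
  under eq_bigr => g _ do rewrite mulr_suml.
  rewrite exchange_big; apply: eq_bigr => x _ /=.
  rewrite (bigD1 (lk x)) //= eqxx mulr1 big1 ?addr0 // => g gx.
  by rewrite eq_sym (negPf gx) mulr0 mul0r.
pose d := bd l.
have d0 p : lab p = None -> d p = 0.
  move=> pN; rewrite /d /bd sumlk big1 // => x _.
  have [N1 N2]: e1 (lk x) != p /\ e2 (lk x) != p.
    by split; apply/eqP => Ep; case: (lk_lab x) => -[]; rewrite Ep pN.
  by rewrite (negPf N1) (negPf N2) addr0 mulr0.
pose f g := l g + \sum_p d p * pi p g.
have piN p g : pi p g != 0 -> g \notin codom lk.
  move=> /pi1 [_ E12 _]; apply/codomP => -[x gx]; have := ab_neq x.
  by case: (lk_lab x) => -[]; rewrite -gx E12 => -> [->]; rewrite eqxx.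
exists f; split.
- move=> q; rewrite /bd /f; under eq_bigr => g _ do rewrite mulrDl mulr_suml.
  rewrite big_split /= exchange_big /= -[X in X + _]/(d q).
  under [X in _ + X]eq_bigr => p _.
    under eq_bigr => g _ do rewrite -mulrA.
    rewrite -mulr_sumr -[X in _ * X]/(bd (pi p) q) pi2 mulrDr; over.
  rewrite big_split /= addrA.
  have ->: \sum_i d i * (i == q)%:R = d q.
    rewrite (bigD1 q) //= eqxx mulr1 big1 ?addr0 // => p /negPf ->.
    by rewrite mulr0.
  rewrite addF2 add0r (bigID (fun p => lab p)) /= addrC big1 ?add0r; last first.
    by move=> p; case Elab: (lab p) => // _; rewrite d0 ?mul0r.
  (* The remaining boundary sits at the roots. Grouped by fibres, its coefficient at [r v] is the
     degree of [c] at [v]. *)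
  transitivity (\sum_(v : V) \sum_(p | lab p == Some v) d p * (r v == q)%:R).
    rewrite (exchange_big_dep (fun p => lab p : bool)) /=; last first.
      by move=> v p _ /eqP ->.
    apply: eq_bigr => p; case Elab: (lab p) => [v|] // _.
    rewrite (eq_bigl (pred1 v)); last by move=> w /=; rewrite (inj_eq Some_inj) eq_sym.
    by rewrite big_pred1_eq /root Elab.
  apply: big1 => v _; rewrite -mulr_suml bd_sum_lab sumlk.
  under eq_bigr => x _ do rewrite lab_inc.
  by rewrite cE mul0r.
- move=> g E12; rewrite /f l0 ?add0r; last first.
    by apply/codomP => -[x gx]; have := lk_noloop x; rewrite -gx E12 eqxx.
  apply: big1 => p _; have [->|/pi1[_ _]] := eqVneq (pi p g) 0; first by rewrite mulr0.
  by rewrite E12 eqxx.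
- move=> x; rewrite /f lE big1 ?addr0 // => p _.
  have [->|/piN] := eqVneq (pi p (lk x)) 0; first by rewrite mulr0.
  by rewrite codom_f.
move=> g fg; have [|gN] := boolP (g \in codom lk); first by left.
right; apply/eqP; apply: contraNT fg => E12; rewrite /f l0 // add0r.
apply/eqP/big1 => p _; have [->|/pi1[_ /eqP]] := eqVneq (pi p g) 0; first by rewrite mulr0.
by rewrite (negPf E12).
Qed.

(* Lift a basis of the cycle space to even edge sets of the host and label each
   side of a linking edge by the vector of the potentials of these lifts: the
   labels of the two sides of x differ by the x-th column of the basis, so there
   are at least as many labels as the dimension of the cycle space. *)
Lemma minor_faces : exists (A : finType) (f1 f2 : E -> A),
  (forall (y : A) v, \sum_x ((f1 x == y)%:R + (f2 x == y)%:R) * inc x v = 0) /\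
  (#|E| <= #|V| + #|[set y | [exists x, (f1 x != f2 x) && ((f1 x == y) || (f2 x == y))]]|)%N.
Proof.
(* [M] is the incidence matrix; the rows of [C] form a basis of its left kernel, the cycle space. *)
pose M := \matrix_(i < #|E|, j < #|V|) inc (enum_val i) (enum_val j).
pose d := \rank (kermx M); pose C := row_base (kermx M).
have CM : C *m M = 0.
  by apply/sub_kermxP; rewrite eq_row_base.
have Ck k : exists2 f : G -> 'F_2,
    (forall p, bd f p = 0) /\ (forall g, e1 g = e2 g -> f g = 0) &
    (forall x, f (lk x) = C k (enum_rank x)) /\
    (forall g, f g != 0 -> g \in codom lk \/ (lab (e1 g) = lab (e2 g))).
  apply: cycle_lift => v.
  have /matrixP /(_ k (enum_rank v)) := CM; rewrite !mxE.
  apply: etrans.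
  rewrite (reindex (@enum_val E E)) /=; last first.
    by apply: onW_bij; apply: enum_val_bij.
  by apply: eq_bigr => i _; rewrite enum_valK [M _ _]mxE enum_rankK.
have Ck' k : exists fw : (G -> 'F_2) * (Q -> 'F_2),
    [/\ forall g, fw.1 g = fw.2 (s1 g) + fw.2 (s2 g),
    (forall x, fw.1 (lk x) = C k (enum_rank x)) &
    (forall g, fw.1 g != 0 -> g \in codom lk \/ (lab (e1 g) = lab (e2 g)))].
  have [f [ff1 ff2] [ff3 ff4]] := Ck k; have [w wP] := even_potential ff1 ff2.
  by exists (f, w).
have {Ck Ck'} [fw /all_and3 [fw1 fw2 fw3]] := fin_all_exists Ck'.
pose W q : 'rV['F_2]_d := \row_k (fw k).2 q.
have Wadd x : W (s1 (lk x)) + W (s2 (lk x)) = \row_k C k (enum_rank x).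
  by apply/rowP => k; rewrite [LHS]mxE ![W _ _ _]mxE [RHS]mxE -fw1 fw2.
exists 'rV['F_2]_d, (W \o s1 \o lk), (W \o s2 \o lk); split=> [y v /=|].
  (* The set of faces labelled [y] has an edge boundary that is even at inner points. Only links
     contribute to [F]: any other edge has equal labels on its sides or both ends with the same
     [lab]. *)
  pose D q : 'F_2 := (W q == y)%:R.
  pose F g := (D (s1 g) + D (s2 g)) * ((lab (e1 g) == Some v)%:R + (lab (e2 g) == Some v)%:R).
  have F0 g : g \notin codom lk -> F g = 0.
    move=> gN; rewrite /F.
    have [Wg|/eqP Wg] := eqVneq (W (s1 g)) (W (s2 g)).
      by rewrite /D Wg addF2 mul0r.
    have [E12|E12] := eqVneq (lab (e1 g)) (lab (e2 g)).
      by rewrite E12 addF2 mulr0.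
    case: Wg; apply/rowP => k; rewrite !mxE; apply: addF2_eq; rewrite -fw1.
    apply/eqP; apply: contraNT gN => /fw3 [//|/eqP].
    by rewrite (negPf E12).
  transitivity (\sum_g F g); last first.
    rewrite -(bd_sum_lab (fun g => D (s1 g) + D (s2 g))) big1 // => p /eqP pv.
    by apply: potential_even; apply: lab_inner; rewrite pv.
  rewrite (bigID (mem (codom lk))) /= [X in _ = _ + X]big1 ?addr0; last by move=> g /F0.
  under eq_bigr => x _ do rewrite -lab_inc.
  rewrite -[LHS](big_imset F (h := lk) (A := predT)) /=; last by move=> x y' _ _ /lk_inj.
  apply: eq_bigl => g; apply/imsetP/codomP => [[x _ ->]|[x ->]]; by exists x.
set S := [set y | _].
have dE : (#|E| <= #|V| + d)%N.
  rewrite /d mxrank_ker -leq_subLR leq_sub2l //.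
  exact: rank_leq_col.
apply: leq_trans dE _; rewrite leq_add2l.
(* Each column of [C] is zero or the sum of two occurring labels, so the rank [d] of [C] is at most
   the number of these labels. *)
pose N := \matrix_(i < #|S|) (enum_val i : 'rV['F_2]_d).
have NP y : y \in S -> (y <= N)%MS.
  move=> yS; have <-: row (enum_rank_in yS y) N = y.
    by rewrite rowK enum_rankK_in.
  exact: row_sub.
have : (C^T <= N)%MS.
  apply/row_subP => i.
  have -> : row i C^T = W (s1 (lk (enum_val i))) + W (s2 (lk (enum_val i))).
    by rewrite Wadd; apply/rowP => k; rewrite !mxE enum_valK.
  have [->|neq] := eqVneq (W (s1 (lk (enum_val i)))) (W (s2 (lk (enum_val i)))).
    have -> : forall y : 'rV['F_2]_d, y + y = 0.
      by move=> y; apply/rowP => k; rewrite !mxE addF2.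
    exact: sub0mx.
  apply: addmx_sub; apply: NP; rewrite inE; apply/existsP; exists (enum_val i) => /=;
  by rewrite neq eqxx ?orbT.
move/mxrankS; rewrite mxrank_tr => CN; apply: leq_trans (rank_leq_row N).
by apply: leq_trans CN; have := row_base_free (kermx M); rewrite /row_free => /eqP ->.
Qed.

End MinorFaces.

Lemma sum_pair (I J : finType) (F : I * J -> 'F_2) :
  \sum_p F p = \sum_i \sum_j F (i, j).
Proof. by rewrite pair_bigA; apply: eq_bigr => -[]. Qed.

(** * Even edge sets and face potentials of the square grid *)

Section Grid.

Variable n : nat.
Definition pixel : finType := ('I_n * 'I_n)%type.
Definition gedge : finType := (pixel * bool)%type.

Definition opred (i : 'I_n) : 'I_n := Ordinal (leq_ltn_trans (leq_pred i) (ltn_ord i)).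

(* (p, true) joins p to its left neighbour, (p, false) to the one below; on the
   left and lower sides of the grid these are loops. *)
Definition gsrc (g : gedge) : pixel :=
  if g.2 then (opred g.1.1, g.1.2) else (g.1.1, opred g.1.2).
Definition gtgt (g : gedge) : pixel := g.1.
(* The square (i, j) has upper right corner (i, j). *)
Definition gside1 (g : gedge) : nat * nat := (val g.1.1, val g.1.2).
Definition gside2 (g : gedge) : nat * nat :=
  if g.2 then (val g.1.1, (val g.1.2).+1) else ((val g.1.1).+1, val g.1.2).
Definition ginner (p : pixel) : bool :=
  [&& (0 < p.1)%N, (0 < p.2)%N, (p.1.+1 < n)%N & (p.2.+1 < n)%N].

Implicit Types (f : gedge -> 'F_2) (i j : 'I_n).

Definition gext f (i j : nat) b : 'F_2 :=
  if insub i is Some i' then if insub j is Some j' then f ((i', j'), b) else 0 else 0.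

Lemma gextE f i j b : gext f i j b = f ((i, j), b).
Proof. by rewrite /gext !valK. Qed.

(** The truncated predecessor sends to [i] the index [i.+1], if it is in range, and for [i = 0] also
    [0] itself; the latter gives the loops of the grid. *)
Lemma sum_opred (F : 'I_n -> 'F_2) i :
  \sum_k F k * (opred k == i)%:R =
  (i == 0 :> nat)%:R * F i + (if insub i.+1 is Some k then F k else 0).
Proof.
have H k : (opred k == i)%:R = ((k == i) && (i == 0 :> nat))%:R + (val k == i.+1)%:R :> 'F_2.
  rewrite -!val_eqE /=; case: (nat_of_ord k) (nat_of_ord i) => [|k'] [|i'] //=;
  by rewrite ?andbF ?addr0 ?add0r ?eqSS.
under eq_bigr => k _ do rewrite H mulrDr.
rewrite big_split /=; congr (_ + _).
  rewrite (bigD1 i) //= eqxx /= mulrC big1 ?addr0 // => k /negPf ->.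
  by rewrite mulr0.
case: insubP => [k _ kE|].
  rewrite (bigD1 k) //= kE eqxx mulr1 big1 ?addr0 // => k' kk'.
  by rewrite -kE val_eqE (negPf kk') mulr0.
move=> iN; apply: big1 => k _; case: eqP => [kE|]; last by rewrite mulr0.
by rewrite -kE ltn_ord in iN.
Qed.

Lemma bd_grid f i j : bd gsrc gtgt f (i, j) =
  ((0 < i)%N%:R * gext f i j true + gext f i.+1 j true) +
  ((0 < j)%N%:R * gext f i j false + gext f i j.+1 false).
Proof.
rewrite /bd sum_pair /=.
under eq_bigr => p _ do rewrite big_bool /=.
rewrite big_split /=.
have H b : \sum_p f (p, b) * (p == (i, j))%:R = gext f i j b.
  rewrite gextE (bigD1 (i, j)) //= eqxx mulr1 big1 ?addr0 // => p /negPf ->.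
  by rewrite mulr0.
have K (m : nat) (x : 'F_2) : (0 < m)%N%:R * x = x + (m == 0)%:R * x.
  by case: m => [|m]; rewrite /= ?mul0r ?mul1r ?addF2 ?addr0.
congr (_ + _).
  under eq_bigr => p _ do rewrite mulrDr.
  rewrite big_split /= H addrC K -addrA; congr (_ + _).
  rewrite sum_pair exchange_big /=.
  rewrite (bigD1 j) //= [X in _ + X]big1 ?addr0; last first.
    move=> l /negPf lj; apply: big1 => k _.
    by rewrite /gsrc /= xpair_eqE lj andbF mulr0.
  under eq_bigr => k _ do rewrite /gsrc /= xpair_eqE eqxx andbT.
  rewrite (sum_opred (fun k => f ((k, j), true))) gextE; congr (_ + _).
  by rewrite /gext valK.
under eq_bigr => p _ do rewrite mulrDr.
rewrite big_split /= H addrC K -addrA; congr (_ + _).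
rewrite sum_pair /=.
rewrite (bigD1 i) //= [X in _ + X]big1 ?addr0; last first.
  move=> l /negPf lj; apply: big1 => k _.
  by rewrite /gsrc /= xpair_eqE lj mulr0.
under eq_bigr => k _ do rewrite /gsrc /= xpair_eqE eqxx /=.
rewrite (sum_opred (fun k => f ((i, k), false))) gextE; congr (_ + _).
by rewrite /gext valK.
Qed.

(** The potential of a square counts the edges of [f] crossed by a horizontal ray entering from the
    left. Across a vertical edge it changes by definition; across a horizontal edge the evenness at
    the pixels to the left telescopes. *)
Lemma grid_even_potential f :
  (forall p, bd gsrc gtgt f p = 0) -> (forall g, gsrc g = gtgt g -> f g = 0) ->
  exists w : nat * nat -> 'F_2, forall g, f g = w (gside1 g) + w (gside2 g).
Proof.
move=> f0 fl; exists (fun q => \sum_(k < q.1) gext f k q.2 false).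
have f_left (j : nat) : gext f 0 j true = 0.
  rewrite /gext; case: insubP => // i0 _ i0E; case: insubP => // j' _ _.
  by apply: fl; rewrite /gsrc /=; congr (_, _); apply: val_inj; rewrite /= i0E.
have f_down (i : nat) : gext f i 0 false = 0.
  rewrite /gext; case: insubP => // i' _ _; case: insubP => // j0 _ j0E.
  by apply: fl; rewrite /gsrc /=; congr (_, _); apply: val_inj; rewrite /= j0E.
have even i j : gext f i j true + gext f i.+1 j true = gext f i j false + gext f i j.+1 false.
  have := f0 (i, j); rewrite bd_grid.
  have -> : (0 < i)%N%:R * gext f i j true = gext f i j true.
    by have [->|_] := posnP (val i); rewrite ?f_left ?mulr0 ?mul1r.
  have -> : (0 < j)%N%:R * gext f i j false = gext f i j false.
    by have [->|_] := posnP (val j); rewrite ?f_down ?mulr0 ?mul1r.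
  exact: addF2_eq.
move=> [[i j] [|]]; rewrite /gside1 /gside2 /=; last first.
  by rewrite big_ord_recr /= addrA addF2 add0r gextE.
rewrite -big_split /=.
under eq_bigr => k _.
  rewrite -(even (Ordinal (ltn_trans (ltn_ord k) (ltn_ord i)))) /=; over.
have tel (m : nat) : \sum_(k < m) (gext f k j true + gext f k.+1 j true) = gext f m j true.
  elim: m => [|m IH]; first by rewrite big_ord0 f_left.
  by rewrite big_ord_recr /= IH addrA addF2 add0r.
by rewrite tel gextE.
Qed.

(** Each of the four squares around an inner pixel is a side of exactly two of the four edges there,
    so it cancels. *)
Lemma grid_potential_even (D : nat * nat -> 'F_2) p : ginner p ->
  bd gsrc gtgt (fun g => D (gside1 g) + D (gside2 g)) p = 0.
Proof.
case: p => i j /and4P [/= i0 j0 iS jS]; rewrite bd_grid i0 j0 !mul1r.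
rewrite -[i.+1]/(val (Ordinal iS)) -[j.+1]/(val (Ordinal jS)) !gextE /gside1 /gside2 /=.
by rewrite [X in _ + X]addrACA addF2.
Qed.

End Grid.

(** * Graphs as minors of the pixel grid *)

Section PixelModel.

Variable n : nat.
Implicit Types (p q : pixel n) (Y : {set pixel n}).

Definition padj p q : bool :=
  ((p.1 == q.1) && ((p.2.+1 == q.2 :> nat) || (q.2.+1 == p.2 :> nat))) ||
  ((p.2 == q.2) && ((p.1.+1 == q.1 :> nat) || (q.1.+1 == p.1 :> nat))).

Definition pconn Y := forall p q, p \in Y -> q \in Y ->
  connect [rel x y | [&& padj x y, x \in Y & y \in Y]] p q.

Lemma padj_sym : symmetric padj.
Proof.
move=> p q; rewrite /padj [q.1 == p.1]eq_sym [q.2 == p.2]eq_sym.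
by congr (_ && _ || _ && _); rewrite orbC.
Qed.

Lemma padj_edge p q : padj p q -> exists2 g : gedge n, gsrc g != gtgt g &
  (gsrc g = p /\ gtgt g = q) \/ (gsrc g = q /\ gtgt g = p).
Proof.
have up (i j k : 'I_n) : j.+1 = k -> opred k = j.
  by move=> jk; apply: val_inj; rewrite /= -jk.
have neq (j k : 'I_n) : j.+1 = k -> j != k.
  by move=> jk; rewrite -val_eqE /= -jk neq_ltn ltnSn.
case: p q => [i j] [k l] /orP [] /= /andP [/eqP <- /orP []] /eqP E.
- exists ((i, l), false); rewrite /gsrc /gtgt /= (up i _ _ E); last by left.
  by rewrite xpair_eqE eqxx /= neq.
- exists ((i, j), false); rewrite /gsrc /gtgt /= (up i _ _ E); last by right.
  by rewrite xpair_eqE eqxx /= neq.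
- exists ((k, j), true); rewrite /gsrc /gtgt /= (up i _ _ E); last by left.
  by rewrite xpair_eqE eqxx /= andbT neq.
- exists ((i, j), true); rewrite /gsrc /gtgt /= (up i _ _ E); last by right.
  by rewrite xpair_eqE eqxx /= andbT neq.
Qed.

(** The edges of a path, added modulo 2, have the two ends of the path as boundary. *)
Lemma connect_joined (V : finType) (lab : pixel n -> option V) v Y p q :
  (forall p, p \in Y -> lab p = Some v) ->
  connect [rel x y | [&& padj x y, x \in Y & y \in Y]] p q ->
  joined (@gsrc n) (@gtgt n) lab v p q.
Proof.
move=> labY /connectP [s]; elim: s p => [|p' s IH] p /=.
  move=> _ ->; exists (fun=> 0) => [g|q']; first by rewrite eqxx.
  by rewrite addF2 /bd big1 // => g _; rewrite mul0r.
case/andP => /and3P [pp' pY p'Y] /IH {}IH /IH [f f1 f2].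
have [g gl gE] := padj_edge pp'.
have gY : lab (gsrc g) = Some v /\ lab (gtgt g) = Some v.
  by case: gE => -[-> ->]; rewrite !labY.
exists (fun h => f h + (h == g)%:R) => [h|q'].
  by have [-> _|_] := eqVneq h g; [case: gY | rewrite addr0 => /f1].
rewrite /bd; under eq_bigr => h _ do rewrite mulrDl.
rewrite big_split /= -[X in X + _]/(bd _ _ f q') f2.
rewrite (bigD1 g) //= eqxx mul1r big1 ?addr0; last first.
  by move=> h /negPf ->; rewrite mul0r.
have -> : (gsrc g == q')%:R + (gtgt g == q')%:R = (p == q')%:R + (p' == q')%:R :> 'F_2.
  by case: gE => -[-> ->] //; rewrite addrC.
by rewrite addrC addrA -[X in X + _]addrA addF2 addr0.
Qed.

Variables (T : finType) (e : rel T) (B : T -> {set pixel n}) (S : T -> T -> {set pixel n}).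

(** A minor model of the subdivided graph: [B x] is the branch set of the vertex [x] and [S x y]
    that of the vertex subdividing the edge xy. By [pm_SS], segments may overlap only when they
    belong to the two orientations of one edge. *)
Record pixel_model : Prop := PixelModel {
  pm_innerB : forall x p, p \in B x -> ginner p;
  pm_innerS : forall x y p, e x y -> p \in S x y -> ginner p;
  pm_connB : forall x, pconn (B x);
  pm_connS : forall x y, e x y -> pconn (S x y);
  pm_B0 : forall x, exists p, p \in B x;
  pm_BB : forall x y p, p \in B x -> p \in B y -> x = y;
  pm_BS : forall x y z p, e x y -> p \in S x y -> p \notin B z;
  pm_SS : forall x y u v p, e x y -> e u v -> p \in S x y -> p \in S u v ->
    [set x; y] = [set u; v];
  pm_link1 : forall x y, e x y ->
    exists p q, [/\ p \in B x, q \in S x y & padj p q];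
  pm_link2 : forall x y, e x y ->
    exists p q, [/\ p \in B y, q \in S x y & padj p q]
}.

End PixelModel.

Lemma natF2 (k : nat) : k%:R = (odd k)%:R :> 'F_2.
Proof.
by elim: k => //= k IH; rewrite -natr1 IH; case: odd; rewrite /= ?addF2 ?add0r.
Qed.

Definition arcs (T : finType) (e : rel T) : {set T * T} := [set z | e z.1 z.2].

(* A face a is represented by its boundary, the graph r a; every edge lies on
   at most two boundaries, and the last clause is half of Euler's formula
   (arcs are ordered pairs). *)
Definition has_faces (T : finType) (e : rel T) : Prop :=
  exists (A : finType) (r : A -> rel T),
  [/\ forall a x y, r a x y -> e x y,
      forall a, symmetric (r a),
      forall a x, ~~ odd #|[set y | r a x y]|,
      forall x y, (#|[set a | r a x y]| <= 2)%N &
      (#|arcs e| <= 2 * (#|T| + #|[set a | arcs (r a) != set0]|))%N].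

(** [minor_faces] is applied to the once-subdivided graph, whose vertices are [T + Ed] and whose
    edges are the half-edges [J]. The count then reads [2 * #|Ed| <= #|T| + #|Ed| + faces], and one
    [#|Ed|] cancels. *)
Lemma pixel_model_faces n (T : finType) (e : rel T) B S :
  symmetric e -> irreflexive e -> @pixel_model n T e B S -> has_faces e.
Proof.
move=> e_sym e_irr PM.
(* Orienting each edge by rank gives it a single representative. *)
pose lt (z : T * T) := e z.1 z.2 && (enum_rank z.1 < enum_rank z.2)%N.
pose Ed := {z : T * T | lt z}.
pose J := (Ed * bool)%type; pose V := (T + Ed)%type.
have EdP (z : Ed) : e (val z).1 (val z).2 by case/andP: (valP z).
have EdN (z : Ed) : (val z).1 != (val z).2.
  by apply/eqP => E; have := EdP z; rewrite E e_irr.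
have Ed_set (z z' : Ed) : [set (val z).1; (val z).2] = [set (val z').1; (val z').2] -> z = z'.
  move=> /setP Ezz; apply: val_inj; have /andP[_] := valP z; have /andP[_] := valP z'.
  move: (EdN z) (EdN z') Ezz; case: (val z) (val z') => x y [x' y'] /= xy xy' Ezz lt' lt1.
  have := Ezz x; have := Ezz y; rewrite !inE !eqxx ?orbT => /esym/orP[]/eqP Ey /esym/orP[]/eqP Ex;
  rewrite ?Ex ?Ey //; move: xy lt1; rewrite ?Ex ?Ey ?eqxx // => _.
  by rewrite ltnNge ltnW.
pose lab p : option V := if [pick x | p \in B x] is Some x then Some (inl x) else
  if [pick z : Ed | p \in S (val z).1 (val z).2] is Some z then Some (inr z) else None.
have labB x p : p \in B x -> lab p = Some (inl x).
  rewrite /lab => px; case: pickP => [y py|/(_ x)]; last by rewrite px.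
  by rewrite (pm_BB PM px py).
have labS (z : Ed) p : p \in S (val z).1 (val z).2 -> lab p = Some (inr z).
  rewrite /lab => pz; case: pickP => [x px|_].
    by have := pm_BS PM x (EdP z) pz; rewrite px.
  case: pickP => [z' pz'|/(_ z)]; last by rewrite pz.
  by congr (Some (inr _)); apply: Ed_set; apply: (pm_SS PM (EdP z') (EdP z) pz' pz).
have labK p : match lab p with Some (inl x) => p \in B x
    | Some (inr z) => p \in S (val z).1 (val z).2 | None => true end.
  by rewrite /lab; case: pickP => [x ->//|_]; case: pickP.
pose tl (j : J) := if j.2 then (val j.1).1 else (val j.1).2.
pose hd (j : J) := if j.2 then (val j.1).2 else (val j.1).1.
have lkP (j : J) : exists g : gedge n,
    (lab (gsrc g) = Some (inl (tl j)) /\ lab (gtgt g) = Some (inr j.1)) \/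
    (lab (gsrc g) = Some (inr j.1) /\ lab (gtgt g) = Some (inl (tl j))).
  have [p [q [pB qS pq]]] : exists p q, [/\ p \in B (tl j), q \in S (val j.1).1 (val j.1).2 & padj p q].
    case: j => z [|] /=; [exact: (pm_link1 PM (EdP z)) | exact: (pm_link2 PM (EdP z))].
  have [g _ gE] := padj_edge pq; exists g.
  by case: gE => -[-> ->]; rewrite (labB _ _ pB) (labS _ _ qS); [left | right].
have {lkP} [lk lkP] := fin_all_exists lkP.
have lk_inj : injective lk.
  move=> j j' E; have := lkP j; have := lkP j'; rewrite E.
  have fin (z z' : Ed) (b b' : bool) : z = z' -> tl (z, b) = tl (z', b') -> (z, b) = (z', b').
    move=> <-; rewrite /tl /=; case: b b' => [] [] // /eqP; rewrite ?(negPf (EdN z)) //.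
    by rewrite eq_sym (negPf (EdN z)).
  case: j j' {E} => [z b] [z' b'] [] [-> ->] [] [] //.
    by move=> [Et] [Ez]; apply: fin.
  by move=> [Ez] [Et]; apply: fin.
have conn (v : V) : exists r, forall p, lab p = Some v -> joined (@gsrc n) (@gtgt n) lab v p r.
  case: v => [x|z].
    have [r rB] := pm_B0 PM x; exists r => p pE.
    apply: (connect_joined (Y := B x)); first exact: labB.
    by apply: (pm_connB PM) => //; have := labK p; rewrite pE.
  have [_ [r [_ rS _]]] := pm_link1 PM (EdP z); exists r => p pE.
  apply: (connect_joined (Y := S (val z).1 (val z).2)); first exact: labS.
  by apply: (pm_connS PM (EdP z)) => //; have := labK p; rewrite pE.
have inner p : lab p -> ginner p.
  have := labK p; case: (lab p) => [[x|z]|] // pY _; first exact: (pm_innerB PM pY).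
  exact: (pm_innerS PM (EdP z) pY).
have [A [f1 [f2 [ev cnt]]]] := @minor_faces _ _ _ _ _ _ _ _ (@grid_even_potential n)
  (@grid_potential_even n) V J lab lk (fun j => inl (tl j)) (fun j => inr j.1)
  inner lk_inj (fun=> isT) lkP conn.
(* Exclusive or: a half-edge with the same label on both sides lies on no boundary. *)
pose on a j := (f1 j == a) (+) (f2 j == a).
have onE a j : ((f1 j == a)%:R + (f2 j == a)%:R : 'F_2) = (on a j)%:R.
  by rewrite /on; case: eqP; case: eqP => //= _ _; rewrite ?addF2 ?addr0 ?add0r.
(* The half of the edge xy at [x] stands for the arc [(x, y)], so half-edges correspond to arcs. *)
pose je (j : J) := (tl j, hd j).
have je_inj : injective je.
  move=> [z b] [z' b'] [Et Eh].
  have Ez : z = z'.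
    apply: Ed_set; move: Et Eh; rewrite /tl /hd /=.
    by case: b b' => [] [] -> ->; rewrite // setUC.
  move: Et; rewrite -{}Ez /tl /=; case: b b' {Eh} => [] [] // /eqP; rewrite ?(negPf (EdN z)) //.
  by rewrite eq_sym (negPf (EdN z)).
have je_e j : e (je j).1 (je j).2.
  by case: j => z [|]; rewrite /je /tl /hd /=; [|rewrite e_sym]; apply: EdP.
have je_surj x y : e x y -> exists j, je j = (x, y).
  move=> xy; have [rxy|rxy|/val_inj/enum_rank_inj E] := ltngtP (enum_rank x) (enum_rank y).
  - have Hz : lt (x, y) by rewrite /lt /= xy.
    by exists ((Sub _ Hz : Ed), true).
  - have Hz : lt (y, x) by rewrite /lt /= e_sym xy.
    by exists ((Sub _ Hz : Ed), false).
  - by move: xy; rewrite E e_irr.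
pose r a x y := [exists j, (je j == (x, y)) && on a j].
have rE a j : r a (je j).1 (je j).2 = on a j.
  apply/existsP/idP => [[j' /andP[/eqP]]|oj]; first by rewrite -surjective_pairing => /je_inj ->.
  by exists j; rewrite -surjective_pairing eqxx.
have re a x y : r a x y -> e x y.
  by case/existsP => j /andP[/eqP E _]; have := je_e j; rewrite E.
(* Evenness at the subdividing vertex, which has degree two, puts both halves of an edge on the same
   boundaries. *)
have on_sym a (z : Ed) b : on a (z, b) = on a (z, ~~ b).
  have := ev a (inr z); under eq_bigr => j _ do rewrite onE /inc /= add0r.
  rewrite sum_pair (bigD1 z) //= [X in _ + X]big1 ?addr0; last first.
    by move=> z' /negPf zz'; apply: big1 => b' _ /=; rewrite /eq_op /= zz' mulr0.
  rewrite big_bool /= /eq_op /= eqxx !mulr1 => /addF2_eq.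
  by case: b; case: (on a _); case: (on a _).
exists A, r; split=> //.
- move=> a x y; apply/idP/idP => /existsP [[z b] /andP[/eqP E oz]]; apply/existsP;
  exists (z, ~~ b); rewrite -on_sym oz andbT; move: E; rewrite /je /tl /hd /=; by case: b {oz} => [] /= [-> ->].
- move=> a x; have := ev a (inl x); under eq_bigr => j _ do rewrite onE /inc /= addr0.
  have -> : \sum_(j : J) (on a j)%:R * (inl (tl j) == inl x :> V)%:R = #|[set y | r a x y]|%:R :> 'F_2.
    under eq_bigr => j _ do rewrite -natrM mulnb.
    rewrite -natr_sum; congr (_%:R).
    have -> : [set y | r a x y] = hd @: [set j | on a j & inl (tl j) == inl x :> V].
      apply/setP => y; rewrite inE; apply/existsP/imsetP => [[j /andP[/eqP [tj hj] oj]]|[j]].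
        by exists j; rewrite // inE oj tj eqxx.
      rewrite inE => /andP[oj /eqP [tj]] ->; exists j.
      by rewrite /je tj eqxx.
    rewrite card_in_imset; last first.
      move=> j j'; rewrite !inE => /andP[_ /eqP [tj]] /andP[_ /eqP [tj']] hh.
      by apply: je_inj; rewrite /je tj tj' hh.
    by rewrite -sum1dep_card [RHS]big_mkcond; apply: eq_bigr => j _; case: (_ && _).
  by rewrite natF2; case: odd.
- move=> x y; have [/je_surj [j jE]|exy] := boolP (e x y); last first.
    rewrite (_ : [set a | _] = set0) ?cards0 //; apply/setP => a; rewrite !inE.
    by apply: contraNF exy; apply: re.
  apply: (@leq_trans #|[set f1 j; f2 j]|); last by rewrite cards2; case: eqP.
  apply/subset_leq_card/subsetP => a; rewrite !inE.
  have -> : r a x y = on a j by rewrite -rE jE.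
  by rewrite /on [a == _]eq_sym [a == f2 j]eq_sym; case: eqP; case: eqP.
have EJ : #|arcs e| = #|{: J}|.
  rewrite -(card_imset predT je_inj); apply: eq_card => -[x y]; rewrite inE /=.
  apply/idP/imsetP => [/je_surj [j jE]|[j _ jE]]; last by have := je_e j; rewrite -jE.
  by exists j; rewrite ?jE.
have EJ2 : #|{: J}| = (#|{: Ed}| * 2)%N by rewrite card_prod card_bool.
have EV : #|{: V}| = (#|T| + #|{: Ed}|)%N by rewrite card_sum.
move: cnt; set F := [set y | _]; have -> : F = [set a | arcs (r a) != set0].
  apply/setP => a; rewrite !inE; apply/existsP/set0Pn => [[j /andP[ne oj]]|[z]].
    exists (je j); rewrite inE rE /on; move: oj; case: eqP => [<- _|_ //].
    by rewrite eq_sym (negPf ne).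
  rewrite inE => /existsP [j /andP[_ oj]]; exists j.
  move: oj; rewrite /on; have [->|_] := eqVneq (f1 j) (f2 j); first by rewrite addbb.
  by case: eqP; case: eqP.
rewrite EJ EJ2 EV => cnt.
have : (#|{: Ed}| <= #|T| + #|[set a | arcs (r a) != set0]|)%N.
  by rewrite -(leq_add2l #|{: Ed}|) addnn -muln2 addnCA addnA.
by rewrite mulnC leq_mul2l.
Qed.

End GridFaces.

(** * Euler's inequality and Hall's condition *)

Definition C4_free (T : finType) (e : rel T) : Prop :=
  forall x y z w, e x y -> e y z -> e z w -> e w x -> x != z -> y == w.

Definition tri_arcs (T : finType) (e : rel T) : {set T * T} :=
  [set z | e z.1 z.2 & [exists w, e z.1 w && e z.2 w]].

Section Euler.

Variables (T : finType) (e : rel T).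
Hypothesis e_irr : irreflexive e.
Hypothesis e_C4 : C4_free e.

(* The boundary contains a cycle, hence at least five edges unless it contains a
   triangle. *)
Lemma even_face_size (r : rel T) :
  (forall x y, r x y -> e x y) -> symmetric r ->
  (forall x, ~~ odd #|[set y | r x y]|) -> arcs r != set0 ->
  30 <= 3 * #|arcs r| + 2 * #|arcs r :&: tri_arcs e|.
Proof.
move=> re r_sym r_even /set0Pn [[x y]]; rewrite inE /= => xy.
have neq u v : r u v -> u != v.
  by move=> /re uv; apply/eqP => E; move: uv; rewrite E e_irr.
have next u v : r u v -> exists2 w, r u w & w != v.
  move=> uv; have : 1 < #|[set y | r u y]|.
    have : 0 < #|[set y | r u y]| by apply/card_gt0P; exists v; rewrite inE.
    by have := r_even u; case: #|_| => [|[|]].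
  case/card_gt1P => a [b [ua ub ab]]; rewrite !inE in ua ub.
  have [av|] := eqVneq a v; last by exists a.
  by exists b; rewrite // -av eq_sym.
have big (s : seq (T * T)) : uniq s -> {subset s <= arcs r} -> size s <= #|arcs r|.
  move=> us ss; rewrite -(card_uniqP us); apply/subset_leq_card/subsetP; exact: ss.
have [z xz zy] := next x y xy.
have [w zw wx] : exists2 w, r z w & w != x by apply: next; rewrite r_sym.
have xny := neq _ _ xy; have xnz := neq _ _ xz; have znw := neq _ _ zw.
have [wy|wy] := eqVneq w y.
  rewrite {w}wy in zw wx znw.
  (* A triangle attains the bound: 3 * 6 + 2 * 6 = 30. *)
  suff H : 6 <= #|arcs r :&: tri_arcs e|.
    have H2 : #|arcs r :&: tri_arcs e| <= #|arcs r|.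
      exact/subset_leq_card/subsetIl.
    by apply: (@leq_trans (3 * 6 + 2 * 6)) => //; rewrite leq_add ?leq_mul2l ?H // (leq_trans H).
  pose s := [:: (x, y); (y, x); (x, z); (z, x); (y, z); (z, y)].
  have us : uniq s.
    rewrite /= !inE !xpair_eqE [y == x]eq_sym [z == x]eq_sym [y == z]eq_sym.
    by rewrite (negPf xny) (negPf xnz) (negPf znw) ?andbF.
  rewrite -[6]/(size s) -(card_uniqP us); apply/subset_leq_card/subsetP => c.
  have yx : r y x by rewrite r_sym.
  have zx : r z x by rewrite r_sym.
  have yz : r y z by rewrite r_sym.
  by rewrite !inE; do 5?[case/predU1P => [->|]]; last move/eqP => ->;
     rewrite /= ?xy ?yx ?xz ?zx ?yz ?zw /= re //=; apply/existsP;
     [exists z | exists z | exists y | exists y | exists x | exists x]; rewrite !re.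
have [v yv vx] : exists2 v, r y v & v != x by apply: next; rewrite r_sym.
have ynv := neq _ _ yv.
(* Otherwise [x], [z], [w], [y] would form a 4-cycle. *)
have vw : v != w.
  apply: contraNneq zy => vw; rewrite {v}vw in yv vx ynv.
  by apply: (e_C4 (re _ _ xz) (re _ _ zw) _ _ _); rewrite 1?eq_sym // re // r_sym.
have [u wu uz] : exists2 u, r w u & u != z by apply: next; rewrite r_sym.
(* The walk [v], [y], [x], [z], [w], [u] has five distinct edges, even if it closes up with
   [u = v]. *)
suff r10 : 10 <= #|arcs r|.
  by apply: leq_trans (leq_addr _ _); rewrite (leq_mul2l 3 10).
pose s := [:: (x, y); (y, x); (x, z); (z, x); (z, w); (w, z); (y, v); (v, y); (w, u); (u, w)].
apply: (big s) => [|c].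
  have wnu := neq _ _ wu.
  have sy (a b : T) : a != b -> (a == b) = false /\ (b == a) = false.
    by move=> ab; rewrite [b == a]eq_sym (negPf ab).
  have [h1 h2] := sy _ _ xny; have [h3 h4] := sy _ _ xnz; have [h5 h6] := sy _ _ znw.
  have [h7 h8] := sy _ _ zy; have [h9 h10] := sy _ _ wx; have [h11 h12] := sy _ _ wy.
  have [h13 h14] := sy _ _ vx; have [h15 h16] := sy _ _ ynv; have [h17 h18] := sy _ _ vw.
  have [h19 h20] := sy _ _ uz; have [h21 h22] := sy _ _ wnu.
  rewrite /= !inE !xpair_eqE.
  by rewrite ?(h1, h2, h3, h4, h5, h6, h7, h8, h9, h10, h11, h12, h13, h14, h15,
    h16, h17, h18, h19, h20, h21, h22, andbF).
rewrite !inE; do 9?[case/predU1P => [->|]]; last move/eqP => ->; by rewrite // r_sym.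
Qed.

(** With m arcs, t of them in triangles, n vertices and f faces, summing [even_face_size] gives 30 f
    <= 6 m + 4 t, since an arc lies on at most two boundaries. The face count gives 2 f >= m - 2 n;
    f is eliminated. *)
Lemma euler_bound : has_faces e -> 9 * #|arcs e| <= 30 * #|T| + 4 * #|tri_arcs e|.
Proof.
case=> A [r [re r_sym r_even r_two cnt]]; set F := [set a | _] in cnt.
have two (Y : {set T * T}) : \sum_(a in F) #|arcs (r a) :&: Y| <= 2 * #|Y|.
  have H a : #|arcs (r a) :&: Y| = \sum_(z in Y) (r a z.1 z.2 : nat).
    rewrite -sum1_card [LHS]big_mkcond [RHS]big_mkcond /=; apply: eq_bigr => z _.
    by rewrite !inE andbC; case: (z \in Y) => //=; case: r.
  under eq_bigr => a _ do rewrite H.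
  rewrite exchange_big /= mulnC -sum_nat_const leq_sum // => z _.
  apply: leq_trans (r_two z.1 z.2); rewrite -sum1dep_card [X in _ <= X]big_mkcond /=.
  rewrite big_mkcond /= leq_sum // => a _; case: (a \in F) => //=; by case: r.
have : \sum_(a in F) 30 <= \sum_(a in F) (3 * #|arcs (r a) :&: arcs e| + 2 * #|arcs (r a) :&: tri_arcs e|).
  apply: leq_sum => a; rewrite inE => aF.
  have -> : arcs (r a) :&: arcs e = arcs (r a).
    by apply/setIidPl/subsetP => z; rewrite !inE; apply: re.
  exact: (even_face_size (re a) (r_sym a) (r_even a)).
rewrite sum_nat_const big_split /= -!big_distrr /=.
move: cnt (two (arcs e)) (two (tri_arcs e)); move: #|F| #|arcs e| #|T| #|tri_arcs e| => f m t k.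
by move: (\sum_(_ in _) _) (\sum_(_ in _) _) => p q; lia.
Qed.

End Euler.

Lemma card_dep (S T : finType) (A : {set S}) (F : S -> {set T}) :
  #|[set z : S * T | z.1 \in A & z.2 \in F z.1]| = \sum_(x in A) #|F x|.
Proof.
rewrite -sum1dep_card; under [RHS]eq_bigr => x _ do rewrite -sum1_card.
by rewrite pair_big_dep.
Qed.

Definition swap (T : finType) (z : T * T) := (z.2, z.1).

Lemma swap_inj (T : finType) : injective (@swap T).
Proof. by move=> [a b] [c d] [-> ->]. Qed.

(** This is the only consequence of planarity that the colouring needs; a subgraph is given by an
    injection [i], so that its vertices can be a subset of [T]. *)
Definition hereditary_faces (T : finType) (e : rel T) : Prop :=
  forall (T' : finType) (i : T' -> T) (e' : rel T'), injective i ->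
  symmetric e' -> (forall x y, e' x y -> e (i x) (i y)) -> has_faces e'.

Section HallCondition.

Variables (T : finType) (e : rel T).
Hypothesis e_sym : symmetric e.
Hypothesis e_irr : irreflexive e.
Hypothesis e_C4 : C4_free e.
Hypothesis e_faces : hereditary_faces e.

(** [euler_bound] counts all vertices of the type, so the graph is first moved to the subtype of
    [Y]. *)
Lemma euler_bound_on (Y : {set T}) (e' : rel T) : symmetric e' ->
  (forall x y, e' x y -> e x y /\ x \in Y) ->
  9 * #|arcs e'| <= 30 * #|Y| + 4 * #|tri_arcs e'|.
Proof.
move=> e'_sym e'P; pose T' := {x | x \in Y}; pose e2 : rel T' := relpre val e'.
have vinj : injective (fun z : T' * T' => (val z.1, val z.2)).
  by move=> [a b] [c d] [/val_inj -> /val_inj ->].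
have lift x y : e' x y -> exists z : T' * T', (val z.1, val z.2) = (x, y).
  move=> xy; have [_ xY] := e'P _ _ xy; have [_ yY] : e y x /\ y \in Y by apply: e'P; rewrite e'_sym.
  by exists (Sub x xY, Sub y yY).
have E1 : #|arcs e2| = #|arcs e'|.
  rewrite -(card_imset _ vinj); apply: eq_card => -[x y]; rewrite inE /=.
  apply/imsetP/idP => [[z]|xy]; first by rewrite inE /= => zz [-> ->].
  have [z zE] := lift _ _ xy; exists z; rewrite //= inE.
  by have [z1 z2] := zE; rewrite -z1 -z2 in xy.
have E2 : #|tri_arcs e2| <= #|tri_arcs e'|.
  rewrite -(card_imset _ vinj); apply/subset_leq_card/subsetP => c /imsetP [z].
  rewrite !inE => /andP[zz /existsP [w ww]] -> /=; rewrite [e' _ _]zz /=.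
  by apply/existsP; exists (val w).
have E3 : #|{: T'}| = #|Y| by rewrite card_sig; apply: eq_card.
have : 9 * #|arcs e2| <= 30 * #|{: T'}| + 4 * #|tri_arcs e2|.
  apply: euler_bound.
  - by move=> x; apply/negP => /e'P [] ; rewrite e_irr.
  - move=> x y z w xy yz zw wx xz; apply: (@e_C4 (val x) (val y) (val z) (val w)) => //;
      try by [case: (e'P _ _ xy) | case: (e'P _ _ yz) | case: (e'P _ _ zw) | case: (e'P _ _ wx)].
  - apply: (@e_faces _ val); first exact: val_inj.
      by move=> x y; apply: e'_sym.
    by move=> x y /e'P [].
rewrite E1 E3; move: E2; move: #|arcs e'| #|Y| #|tri_arcs e2| #|tri_arcs e'| => a b c d; lia.
Qed.

Definition nbrs (u : T) : {set T} := [set y | e u y].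
Definition nbhd (X : {set T}) : {set T} := [set y | [exists u in X, e u y]].

(* Euler's bound is applied to the graph on X and the outside vertices y, where
   y keeps only one end of each edge between its neighbours in X, so that no
   triangle leaves X; the edges so dropped are charged to distinct edges of X
   that lie in no triangle of X. *)
Lemma hall_condition (X : {set T}) :
  \sum_(u in X) #|nbrs u| <= 5 * #|X| + #|nbhd X|.
Proof.
pose rk (x : T) : nat := enum_rank x.
pose K y := [set u in X | e y u].
(* The edge from [y] to [u] is dropped when [u] is the higher-ranked end of an edge inside [K y];
   [K' y] keeps the rest. *)
pose dr y u := [exists u', [&& u' \in K y, e u u' & rk u' < rk u]].
pose K' y := [set u in K y | ~~ dr y u].
(* A vertex outside [X] with at most one kept edge is paid for by its own unit in [#|nbhd X|]; only
   those in [N2] enter Euler's bound. *)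
pose N2 := [set y | (y \notin X) && (1 < #|K' y|)].
pose D := [set z : T * T | z.1 \in X & z.2 \in nbrs z.1 :&: X].
pose Dt := [set z in D | [exists w, [&& w \in X, e z.1 w & e z.2 w]]].
pose P2 := [set z : T * T | z.1 \in N2 & z.2 \in K' z.1].
pose dp := [set z : T * T | z.1 \in ~: X & z.2 \in [set u in K z.1 | dr z.1 u]].
pose X' := X :&: nbhd X.
have swapP2 z : (z \in @swap T @: P2) = ((z.2, z.1) \in P2).
  by case: z => x y; apply/imsetP/idP => [[[a b] ab [-> ->]]|xy] //; exists (y, x).
have degX : \sum_(u in X) #|nbrs u| = #|D| + \sum_(y in ~: X) #|K y|.
  rewrite /D (card_dep X (fun u => nbrs u :&: X)) -(card_dep (~: X) K) -(card_imset _ (@swap_inj T)).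
  have -> : @swap T @: [set z | z.1 \in ~: X & z.2 \in K z.1] =
      [set z | z.1 \in X & z.2 \in nbrs z.1 :\: X].
    apply/setP => -[u y]; apply/imsetP/idP => [[[a b]]|]; rewrite !inE /=.
      by case/and3P => aX bX ab [-> ->]; rewrite bX aX e_sym.
    by case/and3P => uX yX uy; exists (y, u); rewrite // !inE /= yX uX e_sym.
  rewrite (card_dep X (fun u => nbrs u :\: X)) -big_split /=; apply: eq_bigr => u _.
  by rewrite cardsID.
have Ksplit : \sum_(y in ~: X) #|K y| = #|dp| + \sum_(y in ~: X) #|K' y|.
  rewrite /dp (card_dep _ (fun y => [set u in K y | dr y u])) -big_split /=; apply: eq_bigr => y _.
  rewrite -(cardsID [set u | dr y u]); congr (_ + _); apply: eq_card => u.
    by rewrite !inE.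
  by rewrite !inE andbC.
have K'sum : \sum_(y in ~: X) #|K' y| + #|N2| <= #|nbhd X :\: X| + #|P2|.
  rewrite /P2 (card_dep _ K') -!sum1_card [in X in _ + X <= _]big_mkcond [X in X + _ <= _]big_mkcond.
  rewrite [X in _ <= X + _]big_mkcond [X in _ <= _ + X]big_mkcond -!big_split /=.
  apply: leq_sum => y _; rewrite !inE.
  case yX : (y \in X) => //=; have [->//|/card_gt0P [u]] := posnP #|K' y|.
  rewrite !inE => /andP[/andP[uX yu] _].
  have -> : [exists u in X, e u y] by apply/existsP; exists u; rewrite uX e_sym.
  by case: ltnP => k1; move: #|K' y| k1 => k; lia.
have P2N2 : 2 * #|N2| <= #|P2|.
  rewrite /P2 (card_dep _ K') mulnC -sum_nat_const leq_sum // => y; by rewrite inE => /andP[].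
have Dsym z : (z \in D) = ((z.2, z.1) \in D).
  by rewrite !inE /= e_sym; case: (z.1 \in X); case: (z.2 \in X); rewrite ?andbF ?andbT.
(* The dropped pair [(y, u)] is charged to the arc from [u] to its lower-ranked partner [pt]. A
   second [y'] charging the same arc, or a triangle of [X] on it, would give a 4-cycle through [y].
   A charged edge has two arcs, hence the factor 2. *)
have tri : 2 * #|dp| + #|Dt| <= #|D|.
  pose DR := [set z in D :\: Dt | rk z.2 < rk z.1].
  have dpE z : z \in dp -> exists u', [&& u' \in K z.1, e z.2 u' & rk u' < rk z.2].
    by rewrite !inE => /and3P[_ _ /existsP].
  pose pt z := odflt z.1 [pick u' | [&& u' \in K z.1, e z.2 u' & rk u' < rk z.2]].
  have ptP z : z \in dp -> [/\ pt z \in X, e z.1 (pt z), e z.2 (pt z) & rk (pt z) < rk z.2].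
    move=> /dpE [u' u'P]; rewrite /pt; case: pickP => [v /= /and3P[]|/(_ u')]; last by rewrite u'P.
    by rewrite inE => /andP[vX zv] zv' rv.
  have dpP z : z \in dp -> [/\ z.1 \notin X, z.2 \in X & e z.1 z.2].
    by rewrite !inE => /and3P[zX /andP[z2 z12] _].
  have dpDR : #|dp| <= #|DR|.
    rewrite -(card_in_imset (f := fun z => (z.2, pt z)) (D := dp)); last first.
      move=> [y u] [y' u'] z1 z2 [/= Eu Ep]; have [/= pX yp up _] := ptP _ z1.
      have [/= _ uX yu] := dpP _ z1; have [/= _ _ y'u'] := dpP _ z2; have [/= _ y'p _ _] := ptP _ z2.
      rewrite -Eu in y'u' y'p Ep *; rewrite -Ep in y'p; congr (_, _); apply/eqP/negPn/negP => yy'.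
      have := @e_C4 y u y' (pt (y, u)) yu _ y'p _ yy'.
      by rewrite e_sym y'u' e_sym yp => /(_ isT isT)/eqP E; move: up; rewrite -E e_irr.
    apply/subset_leq_card/subsetP => c /imsetP [z zd ->].
    have [pX zp z2p rp] := ptP _ zd; have [zX z2 z12] := dpP _ zd.
    rewrite !inE /= rp z2 pX z2p /= !andbT; apply/existsP => -[w /and3P[wX uw pw]].
    have := @e_C4 z.1 z.2 w (pt z) z12 uw.
    rewrite e_sym pw e_sym zp => /(_ isT isT).
    case: eqP => [zw|_ /(_ isT)/eqP E]; first by move: zX; rewrite zw wX.
    by move: z2p; rewrite -E e_irr.
  have DR2 : 2 * #|DR| <= #|D :\: Dt|.
    rewrite mul2n -addnn -{2}(card_imset _ (@swap_inj T)) -cardsUI.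
    rewrite (_ : DR :&: _ = set0) ?cards0 ?addn0; last first.
      apply/setP => z; rewrite in_set0; apply/negbTE/negP; rewrite inE => /andP[].
      rewrite inE => /andP[_ lt1] /imsetP [z']; rewrite inE => /andP[_ lt2] E.
      by move: lt1; rewrite E /= ltnNge ltnW.
    apply/subset_leq_card/subsetP => z; rewrite in_setU => /orP[].
      by rewrite inE => /andP[].
    case/imsetP => z'; rewrite inE => /andP[]; rewrite !inE => /andP[nt /and3P[x1 x12 x2]] _ -> /=.
    rewrite x1 x2 e_sym x12 /= !andbT; move: nt; rewrite x1 x12 x2 /=; apply: contra.
    by case/existsP => w /and3P[wX w1 w2]; apply/existsP; exists w; rewrite wX w1 w2.
  have DtD : Dt \subset D by apply/subsetP => z; rewrite inE => /andP[].
  have := cardsD D Dt; rewrite (setIidPr DtD); have := subset_leq_card DtD.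
  move: dpDR DR2; move: #|dp| #|DR| #|D :\: Dt| #|D| #|Dt| => a b c d f; lia.
(* Euler's bound for the graph induced on [X], with [#|Dt| <= #|D|], gives 5 [#|Dt|] <= 30 [#|X'|].
   Isolated vertices are left out by using [X']. *)
have EX' : #|Dt| <= 6 * #|X'|.
  pose eX x y := [&& e x y, x \in X & y \in X].
  have : 9 * #|arcs eX| <= 30 * #|X'| + 4 * #|tri_arcs eX|.
    apply: euler_bound_on => [x y|x y /and3P[xy xX yX]].
      by rewrite /eX e_sym; congr (_ && _); rewrite andbC.
    by split=> //; rewrite !inE xX; apply/existsP; exists y; rewrite yX e_sym.
  have -> : #|arcs eX| = #|D|.
    apply: eq_card => z; rewrite !inE /eX /=.
    by case: (z.1 \in X); case: (z.2 \in X); rewrite ?andbF ?andbT.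
  have -> : #|tri_arcs eX| = #|Dt|.
    apply: eq_card => z; rewrite !inE /eX /=.
    case: (z.1 \in X); case: (z.2 \in X); rewrite ?andbF ?andbT //=.
    by congr (_ && _); apply: eq_existsb => w; case: (e z.1 w); case: (e z.2 w); rewrite ?andbF ?andbT ?andbb.
  move: tri; move: #|dp| #|D| #|Dt| #|X'| => a b c d; lia.
have E2 : 9 * (#|D| + 2 * #|P2|) <= 30 * (#|X| + #|N2|) + 4 * #|Dt|.
  pose e2 s t := e s t && [|| (s, t) \in D, (s, t) \in P2 | (t, s) \in P2].
  have P2P s t : (s, t) \in P2 -> [/\ s \notin X, t \in X, e s t & ~~ dr s t].
    by rewrite !inE /= => /and3P[/andP[sX _] /andP[tX st] d].
  have e2P s t : e2 s t -> e s t /\ s \in X :|: N2.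
    case/andP => st /or3P[]; rewrite /= !inE /= => H; split=> //.
    - by case/andP: H => ->.
    - by case/andP: H => ->; rewrite orbT.
    - by case/and3P: H => _ /andP[->].
  have e2_sym : symmetric e2.
    move=> s t; rewrite /e2 e_sym Dsym /=; congr (_ && _); congr (_ || _); exact: orbC.
  have := euler_bound_on e2_sym e2P.
  have XN : #|X :|: N2| <= #|X| + #|N2| by rewrite -cardsUI leq_addr.
  have A2 : #|D| + 2 * #|P2| <= #|arcs e2|.
    have DX z : z \in D -> z.1 \in X /\ z.2 \in X by rewrite !inE => /and3P[].
    have d1 : D :&: P2 = set0.
      apply/setP => -[x y]; rewrite in_set0 in_setI; apply/negbTE/negP => /andP[/DX [xX _] /P2P []].
      by rewrite xX.
    have d2 : (D :|: P2) :&: @swap T @: P2 = set0.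
      apply/setP => -[x y]; rewrite in_set0 in_setI swapP2 in_setU; apply/negbTE/negP.
      case/andP => /orP[/DX [xX yX]|/P2P [xX yX _ _]] /P2P [yX' xX' _ _].
        by rewrite yX in yX'.
      by rewrite xX' in xX.
    have -> : #|D| + 2 * #|P2| = #|D :|: P2 :|: @swap T @: P2|.
      rewrite mul2n -addnn addnA -[X in _ + X](card_imset _ (@swap_inj T)).
      by rewrite -[RHS]addn0 -(cards0 (T * T)%type) -d2 cardsUI -cardsUI d1 cards0 addn0.
    apply/subset_leq_card/subsetP => -[x y]; rewrite in_setU swapP2 in_setU.
    have -> : ((x, y) \in arcs e2) = e2 x y by rewrite inE.
    rewrite /e2 /=.
    have eD : (x, y) \in D -> e x y by rewrite !inE => /and3P[].
    case/orP => [/orP[] H|H].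
    - by rewrite H eD.
    - by rewrite H orbT andbT; case/P2P: H.
    - by rewrite H !orbT andbT e_sym; case/P2P: H.
  have T2 : #|tri_arcs e2| <= #|Dt|.
    (* If [s] were outside [X], both [t] and [w] would be kept neighbours of [s]; they are adjacent,
       so the higher-ranked one was dropped. *)
    have inX s t w : e2 s t -> e2 t w -> e2 w s -> s \in X.
      move=> st tw ws; apply/negPn/negP => sX.
      have Ds v : ((s, v) \in D) = false by rewrite !inE /= (negPf sX).
      have Ps v : ((v, s) \in P2) = false by apply/negP => /P2P []; rewrite (negPf sX).
      have [] : (s, t) \in P2 /\ (s, w) \in P2.
        rewrite e2_sym in ws; move: st ws; rewrite /e2 !Ds !Ps !orbF /=.
        by case/andP => _ -> /andP[_ ->].
      case/P2P => _ tX st' dt /P2P [_ wX sw' dw].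
      case/andP: tw => tw _; have tNw : rk t != rk w.
        by apply/eqP => /val_inj/enum_rank_inj E; move: tw; rewrite E e_irr.
      move: tNw; rewrite neq_ltn => /orP[] lt.
        by case/existsP: dw; exists t; rewrite !inE tX st' e_sym tw lt.
      by case/existsP: dt; exists w; rewrite !inE wX sw' tw lt.
    apply/subset_leq_card/subsetP => -[s t]; rewrite inE => /andP[/= st /existsP [w /andP[sw tw]]].
    have ws : e2 w s by rewrite e2_sym.
    have sX := inX _ _ _ st tw ws; have tX := inX _ _ _ tw ws st; have wX := inX _ _ _ ws st tw.
    rewrite !inE /= sX tX; case/andP: st => -> _ /=.
    by apply/existsP; exists w; rewrite wX; case/andP: sw => -> _; case/andP: tw => ->.
  move: XN A2 T2; move: #|D| #|P2| #|X| #|N2| #|_ :|: _| #|arcs _| #|tri_arcs _| #|Dt| => a b c d f g h k; lia.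
have -> : #|nbhd X| = #|X'| + #|nbhd X :\: X| by rewrite /X' setIC cardsID.
(* The claim is the sum of [K'sum], half of [tri], a sixth of [E2], a sixth of [EX'] and twice
   [P2N2]. *)
rewrite degX Ksplit; move: K'sum P2N2 tri EX' E2.
move: (\sum_(_ in _) _) #|D| #|dp| #|N2| #|nbhd _ :\: _| #|P2| #|Dt| #|X'| #|X|.
by move=> a b c d f g h i j; lia.
Qed.

End HallCondition.

(** * Colouring *)

(** The induction of Halmos and Vaughan: at a tight proper subset the problem splits in two. If
    there is none, every nonempty proper subset has a surplus, so one element may be matched
    arbitrarily. [x0] only serves for empty [A]. *)
Lemma hall_marriage (D V : finType) (x0 : V) (A : {set D}) (N : D -> {set V}) :
  (forall S : {set D}, S \subset A -> #|S| <= #|\bigcup_(d in S) N d|) ->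
  exists f : D -> V, {in A &, injective f} /\ {in A, forall d, f d \in N d}.
Proof.
have [k] := ubnP #|A|; elim: k => // k IH in A N * => /ltnSE Ak hall.
have [-> |/set0Pn [d dA]] := eqVneq A set0.
  by exists (fun=> x0); split=> [x y|x]; rewrite inE.
pose tight (S : {set D}) := [&& S != set0, S \proper A & #|\bigcup_(d in S) N d| <= #|S|].
have [/existsP [S /and3P[S0 SA St]]|ntight] := boolP [exists S, tight S].
  have [SA1 /leq_trans/(_ Ak) SA2] := (proper_sub SA, proper_card SA).
  have [|f1 [f1i f1N]] := IH S N SA2; first by move=> S' S'S; apply: hall; apply: subset_trans SA1.
  set NS := \bigcup_(d in S) N d in St.
  have [||f2 [f2i f2N]] := IH (A :\: S) (fun d => N d :\: NS).
  - apply: leq_trans Ak; rewrite cardsD (setIidPr SA1).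
    by rewrite ltn_subrL !card_gt0 S0; apply/set0Pn; exists d.
  - move=> S'; rewrite subsetD => /andP[S'A dis].
    have := hall (S' :|: S); rewrite subUset S'A SA1 => /(_ isT).
    rewrite cardsU disjoint_setI0 // cards0 subn0 bigcup_setU -/NS.
    have -> : \bigcup_(i in S') (N i :\: NS) = (\bigcup_(i in S') N i) :\: NS.
      apply/setP => v; rewrite inE; apply/bigcupP/andP => [[i iS]|[vN /bigcupP [i iS vi]]].
        by rewrite inE => /andP[-> vi]; split=> //; apply/bigcupP; exists i.
      by exists i; rewrite // inE vN.
    have := cardsUI (\bigcup_(i in S') N i) NS; have := cardsID NS (\bigcup_(i in S') N i).
    move: St; move: #|NS| #|_ :\: NS| #|_ :&: NS| #|_ :|: NS| #|S| #|S'| #|\bigcup_(_ in _) _|.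
    move=> a1 a2 a3 a4 a5 a6 a7; lia.
  exists (fun x => if x \in S then f1 x else f2 x); split=> [x y xA yA|x xA]; last first.
    case: ifP => xS; first exact: f1N.
    by have := f2N x; rewrite inE xS xA => /(_ isT); rewrite inE => /andP[].
  have out z w : z \in S -> w \in A -> w \notin S -> f1 z != f2 w.
    move=> zS wA wS; have := f2N w; rewrite inE wS wA => /(_ isT); rewrite inE => /andP[nw _].
    by apply: contraNneq nw => <-; apply/bigcupP; exists z; rewrite // f1N.
  case: ifPn => xS; case: ifPn => yS E.
  - exact: f1i.
  - by have := out _ _ xS yA yS; rewrite E eqxx.
  - by have := out _ _ yS xA xS; rewrite E eqxx.
  - by apply: f2i => //; rewrite inE ?xS ?yS.
have /card_gt0P [v vN] : 0 < #|N d|.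
  by have := hall [set d]; rewrite sub1set dA cards1 big_set1 => /(_ isT).
have [||f [fi fN]] := IH (A :\ d) (fun x => N x :\ v).
- by move: Ak; rewrite (cardsD1 d A) dA.
- move=> S SA; have [->|S0] := eqVneq S set0; first by rewrite cards0.
  have SA' : S \proper A.
    by rewrite properEneq; rewrite subsetD1 in SA; case/andP: SA => -> dS; rewrite andbT; apply: contraNneq dS => ->.
  move: ntight => /existsPn /(_ S); rewrite /tight S0 SA' /= -ltnNge => lt.
  have -> : \bigcup_(i in S) (N i :\ v) = (\bigcup_(i in S) N i) :\ v.
    apply/setP => w; rewrite in_setD1; apply/bigcupP/andP => [[i iS]|[wv /bigcupP [i iS wi]]].
      by rewrite in_setD1 => /andP[-> wi]; split=> //; apply/bigcupP; exists i.
    by exists i; rewrite // in_setD1 wv.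
  by have := cardsD1 v (\bigcup_(i in S) N i); move: lt; move: #|_ :\ v| #|S| #|\bigcup_(_ in _) _| => a1 a2 a3; case: (_ \in _); lia.
exists (fun x => if x == d then v else f x); split=> [x y xA yA|x xA]; last first.
  case: eqP => [->//|/eqP xd]; have := fN x; rewrite !inE xd xA => /(_ isT).
  by case/andP.
have out z : z \in A -> z != d -> f z != v.
  by move=> zA zd; have := fN z; rewrite !inE zd zA => /(_ isT) /andP[].
case: eqP => [->|/eqP xd]; case: eqP => [->|/eqP yd] // E.
- by have := out y yA yd; rewrite -E eqxx.
- by have := out x xA xd; rewrite E eqxx.
- by apply: fi; rewrite // !inE ?xd ?yd.
Qed.

Section PickColouring.

Variables (T : finType) (e : rel T) (g : T -> T) (k : nat).
Hypothesis e_irr : irreflexive e.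
Hypothesis g_edge : forall y, g y != y -> e y (g y).
Hypothesis g_picks : forall u, #|nbrs e u| <= k + #|[set y in nbrs e u | g y == u]|.

(* Colour by the parity of the distance along g to a minimal set K reached by all
   orbits. Only an arc y -> g y with y in K can be monochromatic; then g y has no
   other such neighbour, and its own arc to g (g y) makes up for y. *)
Lemma pick_colouring : exists c : T -> bool,
  forall u, #|[set y in nbrs e u | c y == c u]| <= k.
Proof.
pose reach (K : {set T}) := [forall y, [exists z in K, fconnect g y z]].
have [K minK] : {K | minset reach K}.
  by apply: ex_minset; exists setT; apply/forallP => y; apply/existsP; exists y; rewrite inE connect0.
have KP y : exists2 z, z \in K & fconnect g y z.
  by have /minsetp /forallP/(_ y)/existsP [z /andP[]] := minK; exists z.
(* A point of [K] that reaches another point of [K] could be removed, against minimality. *)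
have K1 y z : y \in K -> z \in K -> fconnect g y z -> y = z.
  move=> yK zK yz; apply/eqP/negPn/negP => yNz.
  suff E : K :\ y = K by move: yK; rewrite -E !inE eqxx.
  apply: (minsetinf minK); last exact: subsetDl; apply/forallP => x; apply/existsP.
  have [w wK xw] := KP x; have [wy|wy] := eqVneq w y.
    exists z; rewrite !inE eq_sym yNz zK /=; apply: connect_trans yz; by rewrite -wy.
  by exists w; rewrite !inE wy wK.
have dP y : exists n, iter n g y \in K.
  by have [z zK yz] := KP y; exists (findex g y z); rewrite iter_findex.
pose d y := ex_minn (dP y).
have d0 y : y \in K -> d y = 0.
  by move=> yK; rewrite /d; case: ex_minnP => m _ /(_ 0 yK); rewrite leqn0 => /eqP.
have dS y : y \notin K -> d y = (d (g y)).+1.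
  move=> yK; rewrite /d; case: ex_minnP => -[|m]; first by rewrite /= (negPf yK).
  rewrite iterSr => mK mmin; case: ex_minnP => m' m'K m'min; apply/eqP.
  by rewrite eqSS eqn_leq m'min // andbT -ltnS mmin // iterSr.
exists (fun y => odd (d y)) => u.
pose O := [set y in nbrs e u | odd (d y) != odd (d u)].
pose I := [set y in nbrs e u | g y == u].
(* By [g_picks], at least [#|nbrs e u| - k] neighbours lie in [I], so it suffices that as many have
   the opposite colour. *)
suff IO : #|I| <= #|O|.
  have := cardsID [set y | odd (d y) == odd (d u)] (nbrs e u); have := g_picks u; rewrite -/I.
  have -> : nbrs e u :\: [set y | odd (d y) == odd (d u)] = O.
    by apply/setP => y; rewrite !inE andbC.
  have -> : nbrs e u :&: [set y | odd (d y) == odd (d u)] = [set y in nbrs e u | odd (d y) == odd (d u)].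
    by apply/setP => y; rewrite !inE.
  move: IO; move: #|I| #|O| #|nbrs e u| #|_| => a1 a2 a3 a4; lia.
have Iopp y : y \in I -> y \notin K -> y \in O.
  by rewrite !inE => /andP[-> /eqP gy] yK; rewrite (dS y yK) gy /=; case: odd.
have [IK|] := boolP (I :&: K == set0).
  apply/subset_leq_card/subsetP => y yI; apply: Iopp => //; apply/negP => yK.
  by move/eqP/setP/(_ y): IK; rewrite in_setI yI yK inE.
case/set0Pn => y0; rewrite in_setI => /andP[y0I y0K].
have uy0 : fconnect g u y0.
  have [z zK uz] := KP u; suff <- : z = y0 by [].
  apply/esym/K1 => //; apply: connect_trans uz; apply: connect1.
  by move: y0I; rewrite !inE => /andP[_].
have y0u : e u y0 by move: y0I; rewrite !inE => /andP[].
have uniq y : y \in I -> y \in K -> y = y0.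
  rewrite inE => /andP[_ gy] yK; apply: K1 => //; apply: connect_trans uy0; exact: connect1.
have [y0O|y0O] := boolP (y0 \in O).
  apply/subset_leq_card/subsetP => y yI; have [yK|yK] := boolP (y \in K); last exact: Iopp.
  by rewrite (uniq y).
have y0c : odd (d u) = false.
  by move: y0O; rewrite !inE y0u /= (d0 y0) //= negbK => /eqP <-.
have uK : u \notin K.
  apply/negP => uK; have uE := K1 _ _ uK y0K uy0.
  by move: y0u; rewrite -uE e_irr.
have gu : g u != u.
  by apply/eqP => E; have := dS u uK; rewrite E => /n_Sn.
have guc : odd (d (g u)) by have := dS u uK => E; move: y0c; rewrite E /=; case: odd.
(* The one monochromatic element [y0] of [I] is replaced by [g u]. *)
have sub : g u |: (I :\ y0) \subset O.
  apply/subsetP => y; rewrite in_setU1 => /orP[/eqP ->|].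
    by rewrite !inE g_edge // guc y0c.
  rewrite in_setD1 => /andP[yy0 yI]; apply: Iopp => //; apply: contraNN yy0 => yK.
  by apply/eqP/uniq.
apply: leq_trans (subset_leq_card sub); rewrite cardsU1 (cardsD1 y0 I) y0I leq_add2r.
(* Otherwise [u] and [g u] would be exchanged by [g] outside [K], while [d] drops at each step. *)
have guI : g u \notin I :\ y0.
  rewrite in_setD1; apply/andP => -[guy0 guI]; have guK : g u \notin K.
    by apply: contraNN guy0 => guK; apply/eqP/uniq.
  have gg : g (g u) = u by move: guI; rewrite !inE => /andP[_ /eqP].
  have E : d u = (d u).+2 by rewrite {1}(dS _ uK) (dS _ guK) gg.
  by have := leqnSn (d u).+1; rewrite -E ltnn.
by rewrite guI.
Qed.

End PickColouring.

(** Each [u] owns [deg u - 5] slots, encoded as pairs [(u, i)]. Hall's theorem matches the slots to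
    distinct neighbours, and [g y] is the owner of the slot matched to [y]. *)
Lemma faces_colouring (T : finType) (e : rel T) :
  symmetric e -> irreflexive e -> C4_free e -> hereditary_faces e ->
  exists c : T -> bool, forall u, #|[set y in nbrs e u | c y == c u]| <= 5.
Proof.
move=> e_sym e_irr e_C4 e_faces.
have [T0|/card_gt0P [x0 _]] := posnP #|T|.
  by exists (fun=> true) => u; have := fintype0 u; rewrite T0 => /(_ erefl).
pose m := #|T|.
pose A := [set z : T * 'I_m | z.2 < #|nbrs e z.1| - 5].
have card_lt j : j <= m -> #|[set i : 'I_m | i < j]| = j.
  move=> jm; rewrite -sum1dep_card (big_ord_narrow jm) /= sum1_card card_ord //.
have degm u : #|nbrs e u| - 5 <= m by apply: leq_trans (leq_subr _ _) (max_card _).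
have [S SA|f [fi fN]] := @hall_marriage _ _ x0 A (fun z => nbrs e z.1).
  pose X := [set z.1 | z in S].
  have XS : #|S| <= \sum_(u in X) (#|nbrs e u| - 5).
    under eq_bigr => u _ do rewrite -(card_lt _ (degm u)).
    rewrite -(card_dep X (fun u => [set i : 'I_m | i < #|nbrs e u| - 5])).
    apply/subset_leq_card/subsetP => z zS; rewrite !inE imset_f //=.
    by have := subsetP SA z zS; rewrite inE.
  (* Elements of [X] own a slot, so their degree exceeds 5 and the subtraction is not truncated. *)
  have X5 : \sum_(u in X) (#|nbrs e u| - 5) + 5 * #|X| = \sum_(u in X) #|nbrs e u|.
    rewrite mulnC -sum_nat_const -big_split /=; apply: eq_bigr => u /imsetP [z /(subsetP SA)].
    by rewrite inE => zA ->; move: #|nbrs _ _| zA => q; lia.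
  have XN : nbhd e X \subset \bigcup_(z in S) nbrs e z.1.
    apply/subsetP => y; rewrite inE => /existsP [u /andP[/imsetP [z zS ->] uy]].
    by apply/bigcupP; exists z; rewrite // inE.
  have := hall_condition e_sym e_irr e_C4 e_faces X; have := subset_leq_card XN.
  move: XS X5; move: (\sum_(_ in _) _) (\sum_(_ in _) _) #|S| #|X| #|nbhd _ _| #|\bigcup_(_ in _) _|.
  by move=> a1 a2 a3 a4 a5 a6; lia.
(* An unmatched [y] gets the default [y], which [g_edge] reads as no pick. *)
pose g y := if [pick z in A | f z == y] is Some z then z.1 else y.
apply: (@pick_colouring T e g 5 e_irr).
  move=> y; rewrite /g; case: pickP => [z /andP[zA /eqP <-] _|_]; last by rewrite eqxx.
  by have := fN z zA; rewrite inE e_sym.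
move=> u; rewrite -leq_subLR -(card_lt _ (degm u)).
have finj : {in [set i : 'I_m | i < #|nbrs e u| - 5] &, injective (fun i => f (u, i))}.
  by move=> i j; rewrite !inE => iA jA /fi; rewrite !inE => /(_ iA jA) [].
rewrite -(card_in_imset finj); apply/subset_leq_card/subsetP => y /imsetP [i]; rewrite inE => iA ->.
have zA : (u, i) \in A by rewrite inE.
have := fN _ zA; rewrite !inE /= => ->; rewrite /g; case: pickP => [z /andP[zA' /eqP /fi E]|/(_ (u, i))].
  by rewrite (E zA' zA) eqxx.
by rewrite zA eqxx.
Qed.

(** * From a drawing to the grid *)

(** The path is followed, starting afresh at each visit to [X] and stopping at the next entry into
    [Y]; the points strictly between form [S]. It is nonempty because [X] and [Y] are neither
    touching nor overlapping. *)
Lemma extract_segment (P : finType) (adj : rel P) (Q X Y : {set P}) a s :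
  let r := [rel p q | [&& adj p q, p \in Q & q \in Q]] in
  symmetric adj -> (forall p q, p \in X -> q \in Y -> p != q /\ ~~ adj p q) ->
  a \in X -> path r a s -> last a s \in Y ->
  exists S : {set P},
  [/\ S \subset Q :\: (X :|: Y),
      forall p q, p \in S -> q \in S -> connect [rel x y | [&& adj x y, x \in S & y \in S]] p q,
      exists p q, [/\ p \in X, q \in S & adj p q] &
      exists p q, [/\ p \in Y, q \in S & adj p q]].
Proof.
move=> r adj_sym XY aX.
pose rS (S : {set P}) := [rel x y | [&& adj x y, x \in S & y \in S]].
have rS_sym S : connect_sym (rS S).
  by apply: sym_connect_sym => x y /=; rewrite adj_sym; congr (_ && _); rewrite andbC.
pose run a := exists S : {set P}, [/\ S \subset Q :\: (X :|: Y), a \in S,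
  exists p q, [/\ p \in X, q \in S & adj p q] & forall q, q \in S -> connect (rS S) q a].
have : a \in X \/ run a by left.
elim: s a {aX} => [|c s IH] a /=.
  move=> [aX _ aY|[S [SQ aS _ _]] _ aY]; first by have [] := XY _ _ aX aY; rewrite eqxx.
  by have := subsetP SQ a aS; rewrite !inE aY orbT.
move=> aH /andP[/and3P[ac aQ cQ] ps] cl.
have [cX|cX] := boolP (c \in X); first by apply: IH ps cl; left.
have [cY|cY] := boolP (c \in Y).
  case: aH => [aX|[S [SQ aS SX Sa]]]; first by have [_] := XY _ _ aX cY; rewrite ac.
  exists S; split=> //; last by exists c, a; rewrite adj_sym.
  by move=> p q pS qS; apply: connect_trans (Sa p pS) _; rewrite rS_sym; apply: Sa.
apply: IH ps cl; right; case: aH => [aX|[S [SQ aS SX Sa]]].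
  exists [set c]; split; rewrite ?set11 //.
  - by rewrite sub1set !inE (negPf cX) (negPf cY).
  - by exists a, c; rewrite set11.
  - by move=> q; rewrite inE => /eqP ->; apply: connect0.
exists (c |: S); split; rewrite ?setU11 //.
- by rewrite subUset sub1set SQ !inE (negPf cX) (negPf cY) cQ.
- by have [p [q [pX qS pq]]] := SX; exists p, q; rewrite in_setU1 qS orbT.
have sub : subrel (connect (rS S)) (connect (rS (c |: S))).
  apply: connect_sub => x y /and3P[xy xS yS]; apply: connect1.
  by rewrite /= xy !in_setU1 xS yS !orbT.
have ac' : connect (rS (c |: S)) a c.
  by apply: connect1; rewrite /= ac !in_setU1 aS eqxx orbT.
move=> q; rewrite in_setU1 => /orP[/eqP ->|qS]; first exact: connect0.
by apply: connect_trans ac'; apply: sub; apply: Sa.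
Qed.

(** Maximum-norm distance at most [k], written without truncated subtraction. *)
Definition pixnear (k : nat) (p q : nat * nat) : bool :=
  [&& p.1 <= q.1 + k, q.1 <= p.1 + k, p.2 <= q.2 + k & q.2 <= p.2 + k].

Lemma pixnearE k p q : pixnear k p q ->
  [/\ p.1 <= q.1 + k, q.1 <= p.1 + k, p.2 <= q.2 + k & q.2 <= p.2 + k].
Proof. by case/and4P. Qed.

(* c x is the pixel of the point x and w x y a walk of pixels along the edge xy;
   steps may be diagonal. *)
Record discrete_drawing (T : finType) (e : rel T) (n r N : nat) (c : T -> nat * nat)
    (w : T -> T -> nat -> nat * nat) : Prop := DiscreteDrawing {
  dd_r : 0 < r;
  dd_start : forall x y, e x y -> w x y 0 = c x;
  dd_end : forall x y, e x y -> w x y N = c y;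
  dd_step : forall x y i, e x y -> i < N -> pixnear 1 (w x y i) (w x y i.+1);
  dd_cbound : forall x, [/\ r < (c x).1, r < (c x).2, (c x).1 + r < n & (c x).2 + r < n];
  dd_wbound : forall x y i, e x y -> i <= N ->
    [/\ 1 < (w x y i).1, 1 < (w x y i).2, (w x y i).1.+1 < n & (w x y i).2.+1 < n];
  dd_centers : forall x y, pixnear (r + r).+1 (c x) (c y) -> x = y;
  dd_avoid : forall x y z i, e x y -> i <= N -> pixnear r.+1 (w x y i) (c z) ->
    z \in [set x; y];
  dd_sep : forall x y u v i j, e x y -> e u v -> i <= N -> j <= N ->
    [set x; y] <> [set u; v] -> pixnear 2 (w x y i) (w u v j) ->
    [\/ pixnear r.-1 (w x y i) (c x), pixnear r.-1 (w x y i) (c y),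
        pixnear r.-1 (w u v j) (c u) | pixnear r.-1 (w u v j) (c v)]
}.

Section Discrete.

Variables (T : finType) (e : rel T) (n r N : nat) (c : T -> nat * nat)
  (w : T -> T -> nat -> nat * nat).
Hypothesis e_irr : irreflexive e.
Hypothesis dd : discrete_drawing e n r N c w.

Let px (q : nat * nat) : pixel n.+1 := (inord q.1, inord q.2).
Let xp (p : pixel n.+1) : nat * nat := (p.1 : nat, p.2 : nat).

Lemma xpK p : px (xp p) = p.
Proof. by case: p => i j; rewrite /px /= !inord_val. Qed.

Lemma pxK q : q.1 <= n -> q.2 <= n -> xp (px q) = q.
Proof. by case: q => i j /= *; rewrite /xp /px /= !inordK. Qed.

Let B x : {set pixel n.+1} := [set p | pixnear r (xp p) (c x)].
(** The walk is thickened by one pixel so that diagonal steps stay connected in [padj]. *)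
Let Q x y : {set pixel n.+1} := [set p | [exists i : 'I_N.+1, pixnear 1 (xp p) (w x y i)]].

Lemma padjE (p q : pixel n.+1) : padj p q =
  ((p.1 == q.1 :> nat) && ((p.2.+1 == q.2 :> nat) || (q.2.+1 == p.2 :> nat))) ||
  ((p.2 == q.2 :> nat) && ((p.1.+1 == q.1 :> nat) || (q.1.+1 == p.1 :> nat))).
Proof. by []. Qed.

Lemma ginnerE (p : pixel n.+1) : ginner p =
  [&& 0 < (xp p).1, 0 < (xp p).2, (xp p).1 < n & (xp p).2 < n].
Proof. by []. Qed.

(** Induction on the distance [m] in the 1-norm to the centre: a step towards it, first horizontally
    and then vertically, stays in the block. *)
Lemma block_conn x : pconn (B x).
Proof.
set rB := [rel a b | [&& padj a b, a \in B x & b \in B x]].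
have rB_sym : connect_sym rB.
  by apply: sym_connect_sym => a b /=; rewrite padj_sym; congr (_ && _); rewrite andbC.
suff H p : p \in B x -> connect rB p (px (c x)).
  by move=> p q /H pc /H qc; apply: connect_trans pc _; rewrite rB_sym.
have [c1 c2 c1n c2n] := dd_cbound dd x.
pose m (q : nat * nat) := (q.1 - (c x).1) + ((c x).1 - q.1) + (q.2 - (c x).2) + ((c x).2 - q.2).
have [k] := ubnP (m (xp p)); elim: k p => // k IH p /ltnSE pk pB.
have step q : q.1 <= n -> q.2 <= n -> pixnear r q (c x) -> m q < m (xp p) ->
    ((xp p).1 = q.1 /\ ((xp p).2.+1 = q.2 \/ q.2.+1 = (xp p).2)) \/
    ((xp p).2 = q.2 /\ ((xp p).1.+1 = q.1 \/ q.1.+1 = (xp p).1)) ->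
    connect rB p (px (c x)).
  move=> q1 q2 qB qm adj; have qE := pxK q1 q2.
  have pq : padj p (px q).
    rewrite padjE /= !inordK //.
    by case: adj => -[/= -> [->|->]]; rewrite !eqxx ?orbT.
  apply: connect_trans (IH (px q) _ _).
  - by apply: connect1; rewrite /= pq pB inE qE.
  - by rewrite qE; apply: leq_trans qm pk.
  - by rewrite inE qE.
have p1 : (xp p).1 <= n by rewrite -ltnS ltn_ord.
have p2 : (xp p).2 <= n by rewrite -ltnS ltn_ord.
have {pB} : pixnear r (xp p) (c x) by rewrite inE in pB.
move=> /pixnearE [n1 n2 n3 n4]; clear IH pk.
have [lt|lt|E1] := ltngtP (xp p).1 (c x).1.
- apply: (step ((xp p).1.+1, (xp p).2)); rewrite /pixnear /m; cbn [fst snd]; clear step; lia.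
- apply: (step ((xp p).1.-1, (xp p).2)); rewrite /pixnear /m; cbn [fst snd]; clear step; lia.
have [lt|lt|E2] := ltngtP (xp p).2 (c x).2.
- apply: (step ((xp p).1, (xp p).2.+1)); rewrite /pixnear /m; cbn [fst snd]; clear step; lia.
- apply: (step ((xp p).1, (xp p).2.-1)); rewrite /pixnear /m; cbn [fst snd]; clear step; lia.
rewrite (_ : px (c x) = p) ?connect0 //.
by rewrite -[RHS]xpK /px E1 E2.
Qed.

Lemma walk_conn x y k : e x y -> k <= N ->
  connect [rel a b | [&& padj a b, a \in Q x y & b \in Q x y]] (px (c x)) (px (w x y k)).
Proof.
move=> xy; elim: k => [|k IH] kN; first by rewrite (dd_start dd).
apply: connect_trans (IH (ltnW kN)) _.
set rQ := [rel a b | _].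
have [a1 a2 a3 a4] := dd_wbound dd xy (ltnW kN).
have [b1 b2 b3 b4] := dd_wbound dd xy kN.
have /and4P[s1 s2 s3 s4] := dd_step dd xy kN.
have mem q i : i <= N -> q.1 <= n -> q.2 <= n -> pixnear 1 q (w x y i) -> px q \in Q x y.
  move=> iN q1 q2 qw; rewrite inE; apply/existsP; exists (inord i).
  by rewrite inordK // pxK.
have nn (q : nat * nat) : pixnear 1 q q by rewrite /pixnear; lia.
have mk : px (w x y k) \in Q x y by apply: (mem _ k) => //; lia.
have mk1 : px (w x y k.+1) \in Q x y by apply: (mem _ k.+1) => //; lia.
(* The corner through which a diagonal step is replaced by two straight ones. *)
pose d := ((w x y k.+1).1, (w x y k).2).
have md : px d \in Q x y by apply: (mem _ k); rewrite /pixnear /d /=; lia.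
have link q q' : px q \in Q x y -> px q' \in Q x y -> q = q' \/ padj (px q) (px q') ->
    connect rQ (px q) (px q').
  by move=> m1 m2 [<-|adj]; rewrite ?connect0 //; apply: connect1; rewrite /= adj m1 m2.
apply: (@connect_trans _ _ (px d)); apply: link => //.
  rewrite /d padjE /= !inordK; try lia.
  have [E|] := eqVneq (w x y k).1 (w x y k.+1).1; [left|right; lia].
  by rewrite -E; case: (w x y k).
rewrite /d padjE /= !inordK; try lia.
have [E|] := eqVneq (w x y k).2 (w x y k.+1).2; [left|right; lia].
by rewrite E; case: (w x y k.+1).
Qed.

(** The segment of xy is cut out of the thickened walk between the blocks of its ends. If two
    segments share a pixel, their walks come within distance 2 there, and [dd_sep] puts the pixel in
    a block at an end of its own edge, which was removed. *)
Lemma discrete_pixel_model : exists B S, @pixel_model n.+1 T e B S.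
Proof.
have cB x : px (c x) \in B x.
  have [c1 c2 c1n c2n] := dd_cbound dd x.
  by rewrite inE pxK; [rewrite /pixnear; lia | lia | lia].
have sep x y : x != y -> forall p q, p \in B x -> q \in B y -> p != q /\ ~~ padj p q.
  move=> xy p q; rewrite !inE => /pixnearE /= [p1 p2 p3 p4] /pixnearE /= [q1 q2 q3 q4].
  suff H : ~ pixnear 1 (xp p) (xp q).
    split; apply/negP; first by move=> /eqP E; apply: H; rewrite E /pixnear; lia.
    rewrite padjE => /orP[] /andP[/eqP E1 /orP[] /eqP E2]; apply: H; rewrite /pixnear /xp;
    by cbn [fst snd]; clear -E1 E2; lia.
  move=> /pixnearE /= [n1 n2 n3 n4]; move/eqP: xy; apply; apply: (dd_centers dd).
  by rewrite /pixnear; lia.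
have segment x y : e x y -> exists S : {set pixel n.+1},
  [/\ S \subset Q x y :\: (B x :|: B y), pconn S,
      exists p q, [/\ p \in B x, q \in S & padj p q] &
      exists p q, [/\ p \in B y, q \in S & padj p q]].
  move=> xy; have /connectP [s ps sl] := walk_conn xy (leqnn N).
  have xNy : x != y by apply/eqP => E; move: xy; rewrite E e_irr.
  apply: (@extract_segment _ (@padj n.+1) (Q x y) (B x) (B y) (px (c x)) s) => //.
  - exact: padj_sym.
  - exact: sep.
  - by rewrite -sl (dd_end dd).
have segment' (z : T * T) : exists S : {set pixel n.+1}, e z.1 z.2 ->
  [/\ S \subset Q z.1 z.2 :\: (B z.1 :|: B z.2), pconn S,
      exists p q, [/\ p \in B z.1, q \in S & padj p q] &
      exists p q, [/\ p \in B z.2, q \in S & padj p q]].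
  have [/segment [S H]|_] := boolP (e z.1 z.2); first by exists S.
  by exists set0.
have [S' S'P] := fin_all_exists segment'.
pose S x y := S' (x, y).
have SQ x y p : e x y -> p \in S x y ->
    [/\ exists2 i, i <= N & pixnear 1 (xp p) (w x y i), p \notin B x & p \notin B y].
  move=> xy pS; have [/subsetP/(_ p pS) /= pQ _ _ _] := S'P (x, y) xy.
  move: pQ; rewrite !in_setD in_setU negb_or => /andP[/andP[-> ->]].
  by rewrite inE => /existsP [i iP]; split=> //; exists i; rewrite // -ltnS.
exists B, S; split.
- move=> x p; have [c1 c2 c1n c2n] := dd_cbound dd x.
  by rewrite inE ginnerE => /pixnearE [k1 k2 k3 k4]; lia.
- move=> x y p xy /(SQ _ _ _ xy) [[i iN /pixnearE [l1 l2 l3 l4]] _ _].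
  by have [h1 h2 h3 h4] := dd_wbound dd xy iN; rewrite ginnerE; lia.
- exact: block_conn.
- by move=> x y xy; have [] := S'P (x, y) xy.
- by move=> x; exists (px (c x)).
- move=> x y p px' py; apply/eqP/negPn/negP => xy.
  by have [] := sep _ _ xy _ _ px' py; rewrite eqxx.
- move=> x y z p xy /(SQ _ _ _ xy) [[i iN /pixnearE [l1 l2 l3 l4]] pX pY]; apply/negP => pZ.
  have : z \in [set x; y].
    apply: (dd_avoid dd xy iN); move: pZ; rewrite inE => /pixnearE [k1 k2 k3 k4].
    by rewrite /pixnear; lia.
  by rewrite !inE => /orP[] /eqP E; move: pX pY; rewrite -E pZ.
- move=> x y u v p xy uv /(SQ _ _ _ xy) [[i iN /pixnearE [i1 i2 i3 i4]] pX pY].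
  move=> /(SQ _ _ _ uv) [[j jN /pixnearE [j1 j2 j3 j4]] pU pV].
  apply/eqP/negPn/negP => /eqP ne.
  have nij : pixnear 2 (w x y i) (w u v j) by rewrite /pixnear; lia.
  have r0 := dd_r dd.
  have [/pixnearE [k1 k2 k3 k4]|/pixnearE [k1 k2 k3 k4]|/pixnearE [k1 k2 k3 k4]|/pixnearE [k1 k2 k3 k4]] := dd_sep dd xy uv iN jN ne nij.
  + by move/negP: pX; apply; rewrite inE /pixnear; lia.
  + by move/negP: pY; apply; rewrite inE /pixnear; lia.
  + by move/negP: pU; apply; rewrite inE /pixnear; lia.
  + by move/negP: pV; apply; rewrite inE /pixnear; lia.
- by move=> x y xy; have [] := S'P (x, y) xy.
- by move=> x y xy; have [] := S'P (x, y) xy.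
Qed.

End Discrete.

From mathcomp Require Import all_classical all_reals all_analysis.
Import numFieldNormedType.Exports.

Local Open Scope classical_set_scope.
Local Open Scope ring_scope.

(** * Compactness estimates and rounding to pixels *)

Section Analytic.

Variable R : realType.
Implicit Types (g : R -> R * R) (s t : R).

(** The retraction of the line onto the unit interval; composing with it makes an arc continuous on
    all of [R]. *)
Definition clamp t : R := Num.max 0 (Num.min 1 t).

Lemma clamp_itv t : clamp t \in `[0, 1].
Proof.
rewrite in_itv /= /clamp le_max lexx /= ge_max ler01 /=.
by rewrite ge_min lexx.
Qed.

Lemma clamp_id t : t \in `[0, 1] -> clamp t = t.
Proof. by rewrite in_itv /= /clamp => /andP[t0 t1]; rewrite min_r ?max_r. Qed.

Lemma clamp_continuous : continuous clamp.
Proof.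
move=> t; apply: (@continuous_max R R (fun=> 0) (fun s => Num.min 1 s)); first exact: cst_continuous.
by apply: (@continuous_min R R (fun=> 1) id); [exact: cst_continuous | exact: cvg_id].
Qed.

Lemma clamp_extension g : {within `[0, 1], continuous g} -> continuous (g \o clamp).
Proof.
move=> /subspace_continuousP cg t; have ct := clamp_itv t.
apply: cvg_comp (cg (clamp t) ct) => U; rewrite /within /= => HU.
move: (@clamp_continuous t _ HU); rewrite /= nbhs_simpl /=.
by apply: (@filterS _ (nbhs t)) => s /=; apply; exact: clamp_itv.
Qed.

Lemma positive_min (F : R * R -> R) : continuous F ->
  (forall s t, s \in `[0, 1] -> t \in `[0, 1] -> 0 < F (s, t)) ->
  exists2 eta : R, 0 < eta &
    forall s t, s \in `[0, 1] -> t \in `[0, 1] -> eta <= F (s, t).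
Proof.
move=> cF F0; pose K : set (R * R) := `[0, 1] `*` `[0, 1].
have K0 : K !=set0 by exists (0, 0); split; rewrite /= in_itv /= lexx ler01.
have cK : compact K by apply: compact_setX; exact: segment_compact.
have [[a b]] := compact_EVT_min K0 cK (continuous_subspaceT cF).
rewrite inE => -[/= aI bI] minF; exists (F (a, b)); first exact: F0.
by move=> s t sI tI; apply: minF; rewrite inE; split.
Qed.

Lemma dist_continuous g1 g2 : continuous g1 -> continuous g2 ->
  continuous (fun z : R * R => `|g1 z.1 - g2 z.2|).
Proof.
move=> c1 c2 z; apply: cvg_norm; apply: cvgB.
  by apply: (continuous_comp _ (c1 z.1)); exact: cvg_fst.
by apply: (continuous_comp _ (c2 z.2)); exact: cvg_snd.
Qed.

(** Uniform continuity: the maximum of [|s - t|] and [eps - |g s - g t|] is positive on the unit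
    square, and its minimum serves as [eta]. *)
Lemma uniform_steps g (eps : R) : continuous g -> 0 < eps ->
  exists2 eta : R, 0 < eta & forall s t, s \in `[0, 1] -> t \in `[0, 1] ->
    `|s - t| < eta -> `|g s - g t| < eps.
Proof.
move=> cg e0.
pose F (z : R * R) : R := Num.max `|z.1 - z.2| (eps - `|g z.1 - g z.2|).
have [|s t _ _|eta eta0 H] := @positive_min F.
- move=> z; apply: (@continuous_max R _ (fun z : R * R => `|z.1 - z.2|) (fun z => eps - `|g z.1 - g z.2|)).
    apply: cvg_norm; apply: cvgB; [exact: cvg_fst | exact: cvg_snd].
  by apply: cvgB; [exact: cvg_cst | exact: dist_continuous].
- rewrite /F lt_max /=; have [->|st] := eqVneq s t; first by rewrite !subrr !normr0 subr0 e0 orbT.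
  by rewrite normr_gt0 subr_eq0 st.
exists eta => // s t sI tI st; have := H s t sI tI; rewrite /F le_max /= leNgt st /=.
by rewrite -subr_gt0; apply: lt_le_trans.
Qed.

(** [F] is the maximum of the distance of the two points and the four slacks [d - |.|]. It is
    positive by hypothesis; when the distance is below its minimum, a slack must be positive. *)
Lemma separation g1 g2 (x y u v : R * R) (d : R) :
  continuous g1 -> continuous g2 ->
  (forall s t, s \in `[0, 1] -> t \in `[0, 1] -> g1 s = g2 t ->
    [\/ `|g1 s - x| < d, `|g1 s - y| < d, `|g2 t - u| < d | `|g2 t - v| < d]) ->
  exists2 eta : R, 0 < eta & forall s t, s \in `[0, 1] -> t \in `[0, 1] ->
    `|g1 s - g2 t| < eta ->
    [\/ `|g1 s - x| < d, `|g1 s - y| < d, `|g2 t - u| < d | `|g2 t - v| < d].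
Proof.
move=> c1 c2 H.
pose n1 a s := d - `|g1 s - a|; pose n2 a t := d - `|g2 t - a|.
pose F (z : R * R) : R := Num.max `|g1 z.1 - g2 z.2|
  (Num.max (Num.max (n1 x z.1) (n1 y z.1)) (Num.max (n2 u z.2) (n2 v z.2))).
have n1c a : continuous (fun z : R * R => n1 a z.1).
  move=> z; apply: cvgB; first exact: cvg_cst.
  by apply: (@dist_continuous g1 (fun=> a)) => // t; exact: cvg_cst.
have n2c a : continuous (fun z : R * R => n2 a z.2).
  move=> z; apply: cvgB; first exact: cvg_cst.
  apply: cvg_norm; apply: cvgB; last exact: cvg_cst.
  by apply: (continuous_comp _ (c2 z.2)); exact: cvg_snd.
have cF : continuous F.
  move=> z; apply: (@continuous_max R _ (fun z : R * R => `|g1 z.1 - g2 z.2|)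
    (fun z => Num.max (Num.max (n1 x z.1) (n1 y z.1)) (Num.max (n2 u z.2) (n2 v z.2)))).
    exact: dist_continuous.
  apply: (@continuous_max R _ (fun z : R * R => Num.max (n1 x z.1) (n1 y z.1))
    (fun z => Num.max (n2 u z.2) (n2 v z.2))).
    by apply: (@continuous_max R _ (fun z : R * R => n1 x z.1) (fun z => n1 y z.1)); [exact: n1c | exact: n1c].
  by apply: (@continuous_max R _ (fun z : R * R => n2 u z.2) (fun z => n2 v z.2)); [exact: n2c | exact: n2c].
have [s t sI tI|eta eta0 etaP] := positive_min cF.
  rewrite /F lt_max /=; apply/orP; have [E|NE] := eqVneq (g1 s) (g2 t); last first.
    left; rewrite normr_gt0; apply: contra NE => /eqP E.
    by rewrite -[g1 s](subrK (g2 t)) E add0r.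
  right; rewrite !lt_max /n1 /n2 !subr_gt0.
  by have [->|->|->|->] := H s t sI tI E; rewrite ?orbT.
exists eta => // s t sI tI st; have := etaP s t sI tI; rewrite /F le_max /= leNgt st /= !le_max.
have pos a : eta <= a -> 0 < a by apply: lt_le_trans.
case/orP => /orP[] /pos; rewrite subr_gt0 => K; by [constructor 1 | constructor 2 | constructor 3 | constructor 4].
Qed.

Lemma finite_positive (I : finType) (Pr : I -> R -> Prop) :
  (forall i a b, 0 < b -> b <= a -> Pr i a -> Pr i b) ->
  (forall i, exists2 a, 0 < a & Pr i a) -> exists2 a, 0 < a & forall i, Pr i a.
Proof.
move=> mono ex.
have ex' i : exists a, 0 < a /\ Pr i a by have [a] := ex i; exists a.
have [f fP] := fin_all_exists ex'.
have a0 : 0 < \big[Num.min/(1 : R)]_i f i.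
  by apply: lt_bigmin => // i _; have [] := fP i.
exists (\big[Num.min/1]_i f i) => // i; have [_] := fP i.
by apply: mono => //; apply: bigmin_le_cond.
Qed.

(** The mesh cell of side [h] containing [q]; the shift by [M] keeps coordinates nonnegative, as
    truncation requires. *)
Definition pix (M h : R) (q : R * R) : nat * nat :=
  (Num.truncn ((q.1 + M) / h), Num.truncn ((q.2 + M) / h)).

Lemma truncn_close (a b : R) (k : nat) : 0 <= a -> 0 <= b -> `|a - b| < k%:R ->
  (Num.truncn a <= Num.truncn b + k)%N.
Proof.
move=> a0 b0; rewrite ltr_norml => /andP[_ ab].
have /andP[al _] := truncn_itv a0; have /andP[_ bu] := truncn_itv b0.
rewrite -ltnS -addSn -(ltr_nat R) natrD; lra.
Qed.

Lemma truncn_far (a b : R) (k : nat) : 0 <= a -> 0 <= b ->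
  (Num.truncn a <= Num.truncn b + k)%N -> (Num.truncn b <= Num.truncn a + k)%N ->
  `|a - b| < k.+1%:R.
Proof.
move=> a0 b0; rewrite -!(ler_nat R) !natrD ltr_norml => H1 H2.
have := truncn_itv a0; have := truncn_itv b0; rewrite -!natr1 => /andP[? ?] /andP[? ?].
by apply/andP; split; lra.
Qed.

Lemma norm_ltP (q : R * R) (a : R) : (`|q| < a) = (`|q.1| < a) && (`|q.2| < a).
Proof. by rewrite prod_normE gt_max. Qed.

Lemma pix_coord_ge0 (M h : R) (q : R * R) : 0 < h -> `|q| <= M ->
  0 <= (q.1 + M) / h /\ 0 <= (q.2 + M) / h.
Proof.
rewrite prod_normE ge_max => h0 /andP[]; rewrite !ler_norml => /andP[? _] /andP[? _].
by split; (apply: divr_ge0; last exact: ltW); lra.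
Qed.

Lemma pix_near (M h : R) (q q' : R * R) (k : nat) : 0 < h ->
  `|q| <= M -> `|q'| <= M -> `|q - q'| < k%:R * h -> pixnear k (pix M h q) (pix M h q').
Proof.
move=> h0 qM q'M.
have [q1 q2] := pix_coord_ge0 h0 qM; have [q1' q2'] := pix_coord_ge0 h0 q'M.
have F (a b : R) : `|a - b| < k%:R * h -> `|(a + M) / h - (b + M) / h| < k%:R.
  by rewrite -mulrBl opprD addrACA subrr addr0 normrM normfV (gtr0_norm h0) ltr_pdivrMr.
rewrite norm_ltP => /andP[/= /F d1 /F d2]; rewrite /pixnear /=.
apply/and4P; split; apply: truncn_close => //; by rewrite distrC.
Qed.

Lemma near_pix (M h : R) (q q' : R * R) (k : nat) : 0 < h ->
  `|q| <= M -> `|q'| <= M -> pixnear k (pix M h q) (pix M h q') -> `|q - q'| < k.+1%:R * h.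
Proof.
move=> h0 qM q'M.
have [q1 q2] := pix_coord_ge0 h0 qM; have [q1' q2'] := pix_coord_ge0 h0 q'M.
have F (a b : R) : `|(a + M) / h - (b + M) / h| < k.+1%:R -> `|a - b| < k.+1%:R * h.
  by rewrite -mulrBl opprD addrACA subrr addr0 normrM normfV (gtr0_norm h0) ltr_pdivrMr.
case/and4P => n1 n2 n3 n4; rewrite norm_ltP /=.
by apply/andP; split; apply: F; apply: truncn_far.
Qed.

End Analytic.

(** * Discretizing a plane drawing *)

Section DrawingDiscrete.

Variables (R : realType) (T : finType) (e : rel T).
Variables (p : T -> R * R) (gamma : T -> T -> R -> R * R).
Hypothesis pd : plane_drawing e p gamma.

Let g x y := gamma x y \o @clamp R.

Lemma g_continuous x y : e x y -> continuous (g x y).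
Proof. by move=> xy; apply: clamp_extension; exact: (drawing_continuous pd). Qed.

Lemma g0 x y : e x y -> g x y 0 = p x.
Proof.
move=> xy; rewrite /g /= clamp_id ?(drawing_start pd) //.
by rewrite in_itv /= lexx ler01.
Qed.

Lemma g1 x y : e x y -> g x y 1 = p y.
Proof.
move=> xy; rewrite /g /= clamp_id ?(drawing_end pd) //.
by rewrite in_itv /= lexx ler01.
Qed.

Lemma unit_cases (t : R) : t \in `[0, 1] -> [\/ t = 0, t = 1 | t \in `]0, 1[].
Proof.
rewrite !in_itv /= => /andP[t0 t1].
have [->|tn0] := eqVneq t 0; first by constructor.
have [->|tn1] := eqVneq t 1; first by constructor.
by constructor; rewrite !lt_neqAle eq_sym tn0 tn1 t0 t1.
Qed.

Lemma g_open x y t : t \in `]0, 1[ -> g x y t = gamma x y t.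
Proof. by rewrite /g /= in_itv /= => /andP[/ltW ? /ltW ?]; rewrite clamp_id // in_itv; apply/andP. Qed.

Lemma g_vertex x y z t : e x y -> t \in `[0, 1] -> g x y t = p z -> z \in [set x; y]%SET.
Proof.
move=> xy /unit_cases [->|->|tI]; rewrite ?(g0 xy) ?(g1 xy).
- by move=> /(drawing_inj pd) ->; rewrite !inE eqxx.
- by move=> /(drawing_inj pd) ->; rewrite !inE eqxx orbT.
by rewrite g_open // => E; case: (drawing_vertex pd xy tI E).
Qed.

(** An arc misses every vertex other than its ends, by a positive distance since it is compact;
    there are finitely many pairs to consider. *)
Lemma point_gap : exists2 d : R, 0 < d &
  (forall x y, `|p x - p y| < d -> x = y) /\
  (forall x y z t, e x y -> t \in `[0, 1] -> `|g x y t - p z| < d -> z \in [set x; y]%SET).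
Proof.
have [||d1 d10 d1P] := @finite_positive R (T * T)%type (fun z a => z.1 != z.2 -> a <= `|p z.1 - p z.2|).
- by move=> z a b _ ba H /H; apply: le_trans.
- move=> [x y] /=; have [->|xy] := eqVneq x y; first by exists 1; rewrite // eqxx.
  exists `|p x - p y| => //; rewrite normr_gt0; apply: contra xy => /eqP E.
  by apply/eqP/(drawing_inj pd); rewrite -[p x](subrK (p y)) E add0r.
have [||d2 d20 d2P] := @finite_positive R (T * T * T)%type (fun z a => e z.1.1 z.1.2 ->
   z.2 \notin [set z.1.1; z.1.2]%SET -> forall t, t \in `[0, 1] -> a <= `|g z.1.1 z.1.2 t - p z.2|).
- by move=> z a b _ ba H H1 H2 t tI; apply: le_trans ba (H H1 H2 t tI).
- move=> [[x y] z] /=; have [xy|] := boolP (e x y); last by exists 1.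
  have [zs|zs] := boolP (z \in [set x; y]%SET); first by exists 1.
  have [||a a0 H] := @positive_min R (fun q => `|g x y q.1 - p z|).
  + apply: (@dist_continuous R (g x y) (fun=> p z)); first exact: g_continuous.
    by move=> t; exact: cvg_cst.
  + move=> s t sI _; rewrite normr_gt0 /=; apply: contra zs => /eqP E.
    by apply: (g_vertex xy sI); rewrite -[g x y s](subrK (p z)) E add0r.
  by exists a => // _ _ t tI; apply: (H t t tI tI).
exists (Num.min d1 d2); first by rewrite lt_min d10.
split=> [x y|x y z t xy tI]; rewrite lt_min => /andP[h1 h2].
  by apply/eqP/negPn/negP => xy; have := d1P (x, y) xy; rewrite leNgt h1.
by apply/negPn/negP => zs; have := d2P ((x, y), z) xy zs t tI; rewrite leNgt h2.
Qed.

(** Arcs with different sets of ends meet only at an end of one of them, so [separation] applies to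
    each pair. *)
Lemma edge_gap (d : R) : 0 < d -> exists2 eta : R, 0 < eta &
  forall x y u v s t, e x y -> e u v -> [set x; y]%SET <> [set u; v]%SET ->
  s \in `[0, 1] -> t \in `[0, 1] -> `|g x y s - g u v t| < eta ->
  [\/ `|g x y s - p x| < d, `|g x y s - p y| < d, `|g u v t - p u| < d | `|g u v t - p v| < d].
Proof.
move=> d0; have [||a a0 H] := @finite_positive R ((T * T) * (T * T))%type (fun z a =>
  e z.1.1 z.1.2 -> e z.2.1 z.2.2 -> [set z.1.1; z.1.2]%SET <> [set z.2.1; z.2.2]%SET ->
  forall s t, s \in `[0, 1] -> t \in `[0, 1] -> `|g z.1.1 z.1.2 s - g z.2.1 z.2.2 t| < a ->
  [\/ `|g z.1.1 z.1.2 s - p z.1.1| < d, `|g z.1.1 z.1.2 s - p z.1.2| < d,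
      `|g z.2.1 z.2.2 t - p z.2.1| < d | `|g z.2.1 z.2.2 t - p z.2.2| < d]).
- move=> z a b _ ba H h1 h2 h3 s t sI tI st; apply: (H h1 h2 h3 s t sI tI).
  exact: lt_le_trans st ba.
- move=> [[x y] [u v]] /=; have [xy|] := boolP (e x y); last by exists 1.
  have [uv|] := boolP (e u v); last by exists 1.
  have [ne|ne] := eqVneq [set x; y]%SET [set u; v]%SET; first by exists 1.
  have [s t sI tI E|a a0 H] := separation (g1 := g x y) (g2 := g u v) (x := p x)
    (y := p y) (u := p u) (v := p v) (d := d) (g_continuous xy) (g_continuous uv).
    have [->|->|so] := unit_cases sI.
    + by constructor 1; rewrite g0 // subrr normr0.
    + by constructor 2; rewrite g1 // subrr normr0.
    have [->|->|to] := unit_cases tI.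
    + by constructor 3; rewrite g0 // subrr normr0.
    + by constructor 4; rewrite g1 // subrr normr0.
    move: E; rewrite !g_open // => E; exfalso.
    exact: (drawing_disjoint pd xy uv (elimN eqP ne) so to E).
  by exists a => // _ _ _; exact: H.
by exists a => // x y u v s t h1 h2 h3; apply: (H ((x, y), (u, v)) h1 h2 h3).
Qed.

Lemma step_size (h : R) : 0 < h -> exists2 eta : R, 0 < eta &
  forall x y s t, e x y -> s \in `[0, 1] -> t \in `[0, 1] -> `|s - t| < eta -> `|g x y s - g x y t| < h.
Proof.
move=> h0; have [||a a0 H] := @finite_positive R (T * T)%type (fun z a => e z.1 z.2 ->
  forall s t, s \in `[0, 1] -> t \in `[0, 1] -> `|s - t| < a -> `|g z.1 z.2 s - g z.1 z.2 t| < h).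
- move=> z a b _ ba H h1 s t sI tI st; apply: (H h1 s t sI tI); exact: lt_le_trans st ba.
- move=> [x y] /=; have [xy|] := boolP (e x y); last by exists 1.
  by have [a a0 H] := uniform_steps (g_continuous xy) h0; exists a.
by exists a => // x y s t xy; apply: (H (x, y) xy).
Qed.

Lemma pix_bounds (M h : R) (r : nat) (q : R * R) : 0 < h ->
  `|q| + r.+2%:R * h <= M ->
  let m := Num.truncn ((M + M) / h) in
  [/\ (r.+1 < (pix M h q).1)%N, (r.+1 < (pix M h q).2)%N,
      ((pix M h q).1 <= m)%N & ((pix M h q).2 <= m)%N].
Proof.
move=> h0 qM m.
have rh : 0 <= r.+2%:R * h by apply: mulr_ge0; [exact: ler0n | exact: ltW].
have qn : `|q.1| <= `|q| /\ `|q.2| <= `|q|.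
  by rewrite prod_normE !le_max !lexx orbT.
have lo (a : R) : `|a| <= `|q| -> (r.+1 < Num.truncn ((a + M) / h))%N.
  rewrite ler_norml => /andP[a1 a2].
  have H : r.+2%:R <= (a + M) / h by rewrite ler_pdivlMr //; lra.
  have /andP[_] := truncn_itv (le_trans (ler0n R _) H).
  by move=> H2; rewrite -ltnS -(ltr_nat R); apply: le_lt_trans H H2.
have hi (a : R) : `|a| <= `|q| -> (Num.truncn ((a + M) / h) <= m)%N.
  rewrite ler_norml => /andP[a1 a2]; apply: le_truncn.
  by rewrite ler_pM2r ?invr_gt0 //; lra.
by case: qn => q1 q2; split; [exact: lo | exact: lo | exact: hi | exact: hi].
Qed.

Lemma drawing_discrete : exists n r N c w, discrete_drawing e n r N c w.
Proof.
have [d0 d00 [gapP gapE]] := point_gap.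
(* A block has radius [r = k + 1] pixels of side [h = d / k]. Centres at pixel distance at most
   [2 * r + 1] are closer than [(2 * k + 4) * h], which is below [d0 = 8 * k * h]. *)
pose d := d0 / 8; have d_gt0 : 0 < d by rewrite divr_gt0.
have [eta eta0 etaP] := edge_gap d_gt0.
(* This makes [3 * h <= eta], as pixels at distance at most 2 come from points closer than [3 * h];
   the summand 10 gives slack in the estimates. *)
pose k := (Num.truncn (3 * d / eta) + 10)%N.
have k0 : (0 : R) < k%:R by rewrite ltr0n /k addn_gt0 orbT.
pose h := d / k%:R; have h0 : 0 < h by rewrite divr_gt0.
have kh : k%:R * h = d by rewrite /h mulrC divfK // gt_eqF.
have eta_h : 3 * h <= eta.
  have : 3 * d / eta <= k%:R.
    have /andP[_ /ltW H] := truncn_itv (x := 3 * d / eta) (ltW (divr_gt0 (mulr_gt0 (ltr0n R 3) d_gt0) eta0)).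
    by apply: le_trans H _; rewrite ler_nat /k addnS ltnS leq_addr.
  by rewrite ler_pdivrMr // -kh mulrCA ler_pM2l.
have [a a0 aP] := step_size h0.
(* Sampling with mesh below [a] moves the arcs by less than [h] per step, hence by at most one
   pixel. *)
pose N := (Num.truncn a^-1).+1.
have N0 : (0 : R) < N%:R by rewrite ltr0n.
have Na : N%:R^-1 < a.
  have av : 0 < a^-1 by rewrite invr_gt0.
  have /andP[_ H] := truncn_itv (ltW av).
  by rewrite -[a]invrK ltf_pV2 ?posrE ?invr_gt0.
pose tt (i : nat) : R := i%:R / N%:R.
have ttI i : (i <= N)%N -> tt i \in `[0, 1].
  move=> iN; rewrite in_itv /= /tt divr_ge0 ?ler0n //= ler_pdivrMr // mul1r ler_nat //.
pose C1 := \big[Num.max/(0 : R)]_(z : T * T * 'I_N.+1) `|g z.1.1 z.1.2 (tt z.2)|.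
pose C2 := \big[Num.max/(0 : R)]_x `|p x|.
pose r := k.+1.
(* A margin of [r + 2] pixels around all vertices and sample points keeps blocks and walks off the
   border of the grid. *)
pose M := C1 + C2 + r.+2%:R * h.
have C10 : 0 <= C1 by apply: bigmax_ge_id.
have C20 : 0 <= C2 by apply: bigmax_ge_id.
have rh : 0 <= r.+2%:R * h by apply: mulr_ge0; [exact: ler0n | exact: ltW].
have pM x : `|p x| + r.+2%:R * h <= M.
  rewrite lerD2r; have : `|p x| <= C2 by apply: (@le_bigmax _ _ _ (0 : R) (fun x => `|p x|)).
  lra.
have gM x y i : (i <= N)%N -> `|g x y (tt i)| + r.+2%:R * h <= M.
  move=> iN; rewrite lerD2r; have : `|g x y (tt i)| <= C1.
    have := @le_bigmax _ _ _ (0 : R) (fun z : T * T * 'I_N.+1 => `|g z.1.1 z.1.2 (tt z.2)|) ((x, y), inord i).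
    by rewrite /= inordK.
  lra.
have pM' x : `|p x| <= M by have := pM x; lra.
have gM' x y i : (i <= N)%N -> `|g x y (tt i)| <= M by move=> /(gM x y); lra.
pose n := (Num.truncn ((M + M) / h) + r).+2.
exists n, r, N, (fun x => pix M h (p x)), (fun x y i => pix M h (g x y (tt i))).
have k10 : (10 : R) <= k%:R by rewrite ler_nat /k leq_addl.
have dE : d0 = 8 * k%:R * h by rewrite -mulrA kh /d; lra.
have kh10 : 10 * h <= k%:R * h by rewrite ler_pM2r.
split=> //.
- by move=> x y xy; rewrite /tt mul0r g0.
- by move=> x y xy; rewrite /tt divff ?gt_eqF // g1.
- move=> x y i xy iN; apply: pix_near => //; [exact: gM' (ltnW iN) | exact: gM' |].
  rewrite mul1r; apply: aP => //; [exact: ttI (ltnW iN) | exact: ttI |].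
  by rewrite distrC /tt -mulrBl -natrB // subSnn mul1r ger0_norm // invr_ge0 ler0n.
- move=> x; have [b1 b2 b3 b4] := pix_bounds h0 (pM x); rewrite /n.
  by split; [exact: ltnW | exact: ltnW | |]; rewrite ltnS ltnW // ltnS leq_add2r.
- move=> x y i xy iN; have [b1 b2 b3 b4] := pix_bounds h0 (gM x y i iN); rewrite /n.
  by split; [exact: leq_trans b1 | exact: leq_trans b2 | |]; rewrite !ltnS;
    [exact: leq_trans b3 (leq_addr _ _) | exact: leq_trans b4 (leq_addr _ _)].
- move=> x y /(near_pix h0 (pM' x) (pM' y)) H; apply: gapP; apply: lt_le_trans H _.
  have -> : (r + r).+2 = (2 * k + 4)%N by rewrite /r addnS addSn mul2n -addnn addn4.
  rewrite dE ler_pM2r // natrD natrM; lra.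
- move=> x y z i xy iN /(near_pix h0 (gM' x y i iN) (pM' z)) H.
  apply: (gapE x y z (tt i)) => //; first exact: ttI.
  apply: lt_le_trans H _; have -> : r.+2 = (k + 3)%N by rewrite addn3.
  by rewrite dE ler_pM2r // natrD; lra.
- move=> x y u v i j xy uv iN jN ne /(near_pix h0 (gM' x y i iN) (gM' u v j jN)) H.
  have close q q' : `|q| <= M -> `|q'| <= M -> `|q - q'| < d -> pixnear r.-1 (pix M h q) (pix M h q').
    by move=> qM qM' qq; apply: pix_near; rewrite // kh.
  have H' : `|g x y (tt i) - g u v (tt j)| < eta by apply: lt_le_trans H eta_h.
  by have [c|c|c|c] := etaP _ _ _ _ _ _ xy uv ne (ttI _ iN) (ttI _ jN) H';
    [constructor 1 | constructor 2 | constructor 3 | constructor 4]; apply: close c => //; apply: gM'.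
Qed.

End DrawingDiscrete.

Lemma planar_has_faces (R : realType) (T : finType) (e : rel T) :
  symmetric e -> irreflexive e -> planar R e -> has_faces e.
Proof.
move=> e_sym e_irr [p [gamma pd]].
have [n [r [N [c [w dd]]]]] := drawing_discrete pd.
have [B [S PM]] := discrete_pixel_model e_irr dd.
exact: pixel_model_faces PM.
Qed.

Lemma planar_sub (R : realType) (T T' : finType) (e : rel T) (e' : rel T') (i : T' -> T) :
  injective i -> (forall x y, e' x y -> e (i x) (i y)) -> planar R e -> planar R e'.
Proof.
move=> i_inj e'e [p [gamma pd]]; exists (p \o i), (fun x y => gamma (i x) (i y)); split.
- by move=> x y /= /(drawing_inj pd)/i_inj.
- by move=> x y /e'e; exact: (drawing_continuous pd).
- by move=> x y /e'e; exact: (drawing_simple pd).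
- by move=> x y /e'e; exact: (drawing_start pd).
- by move=> x y /e'e; exact: (drawing_end pd).
- by move=> x y /e'e; exact: (drawing_rev pd).
- by move=> x y z /e'e xy t tI; exact: (drawing_vertex pd xy tI).
- move=> x y u v /e'e xy /e'e uv ne; apply: (drawing_disjoint pd xy uv) => E; apply: ne.
  by apply: (imset_inj i_inj); rewrite !imsetU1 !imset_set1.
Qed.

Lemma no_4cycle_C4_free (T : finType) (e : rel T) :
  symmetric e -> irreflexive e -> ~ has_cycle 4 e -> C4_free e.
Proof.
move=> e_sym e_irr noC x y z w xy yz zw wx xz; apply/negPn/negP => yw; apply: noC.
have neq a b : e a b -> a != b by move=> ab; apply/eqP => E; move: ab; rewrite E e_irr.
exists [tuple x; y; z; w]; rewrite /ucycle /= xy yz zw wx /= !inE.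
by rewrite !negb_or (neq _ _ xy) xz (eq_sym x) (neq _ _ wx) (neq _ _ yz) yw (neq _ _ zw).
Qed.

Theorem theorem2p3 (R : realType) (T : finType) (e : rel T)
    (e_sym : symmetric e) (e_irr : irreflexive e)
    (e_planar : planar R e) (e_noC4 : ~ has_cycle 4 e) :
  defective_colorable 5 5 e.
Proof.
have C4 := no_4cycle_C4_free e_sym e_irr e_noC4.
have [|c cP] := faces_colouring e_sym e_irr C4.
  move=> T' i e' i_inj e'_sym e'e; apply: (@planar_has_faces R) => //.
    by move=> x; apply/negP => /e'e; rewrite e_irr.
  exact: planar_sub i_inj e'e e_planar.
have bound (b : bool) : (induced_max_degree e [set x | c x == b]%SET <= 5)%N.
  apply/bigmax_leqP => x; rewrite inE => /eqP xb; apply: leq_trans (cP x).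
  by apply/subset_leq_card/fintype.subsetP => y; rewrite !inE xb andbC.
exists [set x | c x == true]%SET, [set x | c x == false]%SET; split=> //.
- by apply/setP => x; rewrite !inE; case: (c x).
- by apply/setP => x; rewrite !inE; case: (c x).
Qed.
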